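(* Let $G$ be a totally disconnected locally compact group and $\phi:G\to G$ a continuous endomorphism. The following are equivalent: (1) $h_{top}(\phi)=\log s(\phi)$; (2) $\mathrm{nub}(\phi)=\{1\}$; (3) $h_{top}(\phi\restriction_{\mathrm{nub}(\phi)})=0$.
   Context: All topological groups are Hausdorff; $\mathbb N$ contains $0$; entropies take values in $[0,\infty]$. Let $\mathcal B(G)$ be the family of compact open subgroups of the totally disconnected locally compact (t.d.l.c.) group $G$. The scale of $\phi$ is $s(\phi)=\min\{[\phi U:U\cap\phi U]:U\in\mathcal B(G)\}$ (a positive integer). A subgroup $U\in\mathcal B(G)$ is minimizing if $s(\phi)=[\phi U:U\cap\phi U]$, and $\mathrm{nub}(\phi)$ is the intersection of all minimizing $U\in\mathcal B(G)$. It is known that $\mathrm{nub}(\phi)$ is compact and $\phi(\mathrm{nub}(\phi))=\mathrm{nub}(\phi)$. For $K\in\mathcal B(G)$ and $n\in\mathbb N$ put $K_{-n}=K\cap\phi^{-1}K\cap\dots\cap\phi^{-n}K$; with $\mu$ a left Haar measure on $G$, $H_{top}(\phi,K)=\limsup_{n\to\infty}-\frac1n\log\mu(K_{-n})$ and $h_{top}(\phi)=\sup\{H_{top}(\phi,K):K\in\mathcal B(G)\}$. The same definition is applied to $\phi\restriction_{\mathrm{nub}(\phi)}$ on the t.d.l.c. group $\mathrm{nub}(\phi)$. *)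

(* Defs.v *)
From HB Require Import structures.
From mathcomp Require Import all_boot all_order all_algebra.
From mathcomp Require Import all_classical all_reals all_analysis.

Set Implicit Arguments.
Unset Strict Implicit.
Unset Printing Implicit Defensive.

Import Order.TTheory GRing.Theory Num.Theory.

Local Open Scope classical_set_scope.
Local Open Scope ring_scope.
Local Open Scope group_scope.
Local Open Scope card_scope.

HB.mixin Record isTopologicalGroup G of Topological G & Group G := {
  mulg_continuous : continuous (fun x : G * G => x.1 * x.2) ;
  invg_continuous : continuous (fun x : G => x^-1)
}.

(* The distinguished point carries no content (a group always has 1); it is
   there because the library's generated sigma-algebras require one.
   Separation is not part of the structure. *)
#[short(type="topologicalGroupType")]
HB.structure Definition TopologicalGroup :=
  {G of PointedTopological G & Group G & isTopologicalGroup G}.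

(* A as a topological group in its own right, with the subspace topology; the
   phantom argument h keys the group structure. *)
Definition subgroup_type (G : topologicalGroupType) (A : set G)
  (h : group_closed [in A]) : Type := set_type A.

Section subgroup_type.
Variables (G : topologicalGroupType) (A : set G) (h : group_closed [in A]).
Local Notation H := (subgroup_type h).

HB.instance Definition _ := SubChoice.copy H (set_type A).
HB.instance Definition _ := Topological.copy H (set_type A).
HB.instance Definition _ := SubChoice_isSubGroup.Build G [in A] H h.
HB.instance Definition _ := isPointed.Build H 1.

Let val_continuous : continuous (val : H -> G).
Proof. exact: (@initial_continuous (set_type A) G set_val). Qed.

Let mulg_continuous : continuous (fun x : H * H => x.1 * x.2).
Proof.
apply: (@continuous_comp_initial (set_type A) (H * H)%type G set_val) => x.
have -> : set_val \o (fun y : H * H => y.1 * y.2) =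
    (fun z : G * G => z.1 * z.2) \o (fun y : H * H => (val y.1, val y.2)).
  by apply/funext => y; reflexivity.
apply: continuous_comp; last exact: mulg_continuous.
apply: cvg_pair => /=.
  by apply: continuous_comp; [exact: cvg_fst|exact: val_continuous].
by apply: continuous_comp; [exact: cvg_snd|exact: val_continuous].
Qed.

Let invg_continuous : continuous (fun x : H => x^-1).
Proof.
apply: (@continuous_comp_initial (set_type A) H G set_val) => x.
have -> : set_val \o (fun y : H => y^-1) = (fun z : G => z^-1) \o val.
  by apply/funext => y; reflexivity.
apply: continuous_comp; [exact: val_continuous|exact: invg_continuous].
Qed.

HB.instance Definition _ :=
  isTopologicalGroup.Build H mulg_continuous invg_continuous.

(* The restriction of f to A when f maps A into A; points of A that f maps
   outside A, if any, are sent to 1. *)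
Definition restriction (f : G -> G) (x : H) : H := insubd (1 : H) (f (val x)).

End subgroup_type.

Section scale_and_nub.
Variable G : topologicalGroupType.
Implicit Types (U A B : set G) (phi : G -> G).

Definition compact_open_subgroup U :=
  [/\ group_closed [in U], compact U & open U].

Definition left_cosets A B : set (set G) := [set [set a * b | b in B] | a in A].

(* [A : B] = n; in particular the index is finite. *)
Definition has_index A B (n : nat) := left_cosets A B #= `I_n.

Definition displacement_index phi U (n : nat) :=
  has_index (phi @` U) (U `&` phi @` U) n.

Definition displacement_indices phi : set nat :=
  [set n | exists2 U, compact_open_subgroup U & displacement_index phi U n].

(* The least displacement index; the default value 0 is only returned when no
   compact open subgroup has a finite displacement index, which does not happen
   for a continuous endomorphism of a t.d.l.c. group. *)
Definition scale phi : nat :=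
  xget 0%N [set n | displacement_indices phi n /\
                    forall m, displacement_indices phi m -> (n <= m)%N].

Definition minimizing phi U :=
  compact_open_subgroup U /\ displacement_index phi U (scale phi).

Definition nub phi : set G := \bigcap_(U in minimizing phi) U.

Lemma nub_group_closed phi : group_closed [in nub phi].
Proof.
split=> [|x y xN yN]; apply: mem_set => U mU.
  by have [[[U1 _] _ _] _] := mU; exact: set_mem U1.
have [[[_ UB] _ _] _] := mU.
by apply: set_mem; apply: UB; apply: mem_set;
  [move/set_mem: xN | move/set_mem: yN]; exact.
Qed.

Definition nub_type phi := subgroup_type (nub_group_closed phi).
HB.instance Definition _ phi := TopologicalGroup.on (nub_type phi).

(* phi (nub phi) = nub phi for a continuous endomorphism phi of a t.d.l.c.
   group, so that this is the genuine restriction of phi. *)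
Definition nub_restriction phi : nub_type phi -> nub_type phi :=
  restriction (h := nub_group_closed phi) phi.

Lemma nub_restrictionE phi (x : nub_type phi) :
  (forall y, nub phi y -> nub phi (phi y)) ->
  val (nub_restriction x) = phi (val x).
Proof.
move=> stable; have xN : nub phi (val x).
  exact: (set_mem (valP (x : set_type (nub phi)))).
rewrite /nub_restriction /restriction insubdK //.
exact: (mem_set (stable _ xN)).
Qed.

End scale_and_nub.

Arguments nub_restriction {G} phi x.

Notation borel_type G := (g_sigma_algebraType (@open G)).

(* Left Haar measure: a nonzero left-invariant Radon measure on the Borel sets
   of a Hausdorff group. *)
Record is_left_haar (R : realType) (G : topologicalGroupType)
    (mu : {measure set (borel_type G) -> \bar R}) : Prop := {
  haar_neq0 : mu setT <> 0%E ;
  haar_compact : forall K : set G, compact K -> (mu K < +oo)%E ;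
  haar_left_invariant : forall (x : G) (A : set (borel_type G)),
    measurable A -> mu [set x * y | y in (A : set G)] = mu A ;
  haar_outer_regular : forall A : set (borel_type G), measurable A ->
    mu A = ereal_inf [set mu U | U in [set U : set G | open U /\ A `<=` U]] ;
  haar_inner_regular : forall U : set G, open U ->
    mu U = ereal_sup [set mu K | K in [set K : set G | compact K /\ K `<=` U]]
}.

Section entropy.
Variables (R : realType) (G : topologicalGroupType).
Variable mu : {measure set (borel_type G) -> \bar R}.
Implicit Types (K : set G) (phi : G -> G).

(* K_{-n} *)
Definition cotrajectory phi K (n : nat) : set G :=
  \bigcap_(i in `I_n.+1) (iter i phi @^-1` K).

Definition H_top phi K : \bar R :=
  limn_esup (fun n => (- (n%:R^-1)%R%:E * lne (mu (cotrajectory phi K n)))%E).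

Definition h_top phi : \bar R :=
  ereal_sup [set H_top phi K | K in @compact_open_subgroup G].

End entropy.

(* Main.v *)
Require Import Defs.
From HB Require Import structures.
From mathcomp Require Import all_boot all_order all_algebra finmap.
From mathcomp Require Import all_classical all_reals all_analysis.
From mathcomp Require Import ring lra.

(* Write U_{-n} for the points whose first n + 1 iterates lie in U, and s for
   the scale. Since phi induces a bijection U / U_{-1} -> phi U / (U ∩ phi U)
   and (U_{-n})_{-1} = U_{-n-1}, each index [U_{-n} : U_{-n-1}] is the
   displacement index of U_{-n}, hence at least s. So H_top(phi, U) >= log s,
   with equality iff some U_{-n} is minimizing. If h_top(phi) = log s, every U
   thus contains a minimizing subgroup and the nub is trivial.

   For the converse one needs that minimizing subgroups are directed downwards.
   This follows from Willis' tidiness: if U is minimizing, a point of U whose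
   n-th iterate is in U has all intermediate iterates in U. The obstruction is
   the group L of homoclinic points of U. It is relatively compact, so
   K = {x | L x ∪ L x^-1 ⊆ U L} is a compact open subgroup containing L, and
   K_{-n} contains U_{-n-M} ∩ K_{-M} for some M; if L were not inside U,
   then K_{-n} would have Haar measure much larger than s^-n.

   Finally, entropy 0 on the nub N makes (N ∩ U)_{-n} stable under phi for some
   n, for each U. A stable open subgroup W of N is the trace on N of a
   minimizing subgroup, so W = N. Hence N ⊆ U for every U, and by compactness
   and directedness every U contains a minimizing subgroup. *)

Set Implicit Arguments.
Unset Strict Implicit.
Unset Printing Implicit Defensive.

Import Order.TTheory GRing.Theory Num.Theory.

Local Open Scope classical_set_scope.
Local Open Scope ring_scope.
Local Open Scope group_scope.

(** * Compactness and families of closed sets *)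

(** If no [A] of [D] were inside [O], the sets A \ O would generate a proper filter on [K], and a
    cluster point would lie in every [A] but not in [O]. *)
Lemma directed_bigcap_sub (T : topologicalType) (K : set T)
    (D : set (set T)) (O : set T) :
  compact K -> D !=set0 -> (forall A, D A -> closed A /\ A `<=` K) ->
  (forall A B, D A -> D B -> exists2 C, D C & C `<=` A `&` B) ->
  open O -> \bigcap_(A in D) A `<=` O -> exists2 A, D A & A `<=` O.
Proof.
move=> cK [A0 DA0] DK Ddir oO capO; apply: contrapT => noA.
have FF : Filter (filter_from D (fun A => A `\` O)).
  apply: filter_from_filter; first by exists A0.
  move=> A B DA DB; have [C DC CAB] := Ddir _ _ DA DB.
  by exists C => // x [Cx Ox]; have [Ax Bx] := CAB _ Cx.
have PF : ProperFilter (filter_from D (fun A => A `\` O)).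
  apply: filter_from_proper => A DA; apply: contrapT => AO0.
  apply: noA; exists A => // x Ax; apply: contrapT => Ox.
  by apply: AO0; exists x.
have [|x [Kx clx]] := cK _ PF.
  by exists A0 => // x [/(DK _ DA0).2].
have inD A : D A -> (A `\` O) x.
  move=> DA; have : closed (A `\` O).
    by apply: closedI; [exact: (DK _ DA).1|exact: open_closedC].
  by apply => V Vx; apply: clx => //; exists A.
have [_ Ox] := inD _ DA0; apply/Ox/capO => A DA.
by have [] := inD _ DA.
Qed.

Lemma decreasing_bigcap_neq0 (T : topologicalType) (A : nat -> set T) :
  compact (A 0%N) -> (forall n, closed (A n)) -> (forall n, A n !=set0) ->
  (forall n, A n.+1 `<=` A n) -> \bigcap_n A n !=set0.
Proof.
move=> cA clA A0 Adec; apply: contrapT => cap0.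
have dec m n : (m <= n)%N -> A n `<=` A m.
  elim: n => [|n IH]; first by rewrite leqn0 => /eqP ->.
  rewrite leq_eqVlt => /orP[/eqP ->//|]; rewrite ltnS => /IH mn.
  exact: subset_trans (Adec n) mn.
have [_ [n _ <-] An] : exists2 B, range A B & B `<=` set0.
  apply: (@directed_bigcap_sub _ (A 0%N)) => //.
  - by exists (A 0%N), 0%N.
  - by move=> _ [n _ <-]; split=> //; exact: dec.
  - move=> _ _ [m _ <-] [n _ <-]; exists (A (maxn m n)); first by exists (maxn m n).
    by move=> x Ax; split; apply: dec Ax; rewrite ?leq_maxl ?leq_maxr.
  - exact: open0.
  - move=> x Ax; apply: cap0; exists x => n _; apply: Ax.
    by exists n.
by have [x /An] := A0 n.
Qed.

(** * Subgroups as predicates *)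

Definition subgp (G : groupType) (A : set G) :=
  A 1 /\ forall x y, A x -> A y -> A (x / y).

Section subgp.
Variable G : groupType.
Implicit Types A B : set G.

Lemma subgp_closed A : subgp A <-> group_closed [in A].
Proof.
split=> -[A1 AB]; split; first exact: mem_set.
- by move=> x y xA yA; apply/mem_set/AB; apply: set_mem; [exact: xA|exact: yA].
- exact: set_mem A1.
- by move=> x y Ax Ay; apply: set_mem; apply: AB; exact: mem_set.
Qed.

Variables (A : set G) (sA : subgp A).

Lemma subgp1 : A 1. Proof. by case: sA. Qed.

Lemma subgpB x y : A x -> A y -> A (x / y).
Proof. by case: sA => _; exact. Qed.

Lemma subgpV x : A x -> A x^-1.
Proof. by move=> Ax; rewrite -div1g; apply: subgpB => //; exact: subgp1. Qed.

Lemma subgpM x y : A x -> A y -> A (x * y).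
Proof. by move=> Ax Ay; rewrite -[y]invgK; apply: subgpB => //; exact: subgpV. Qed.

Lemma subgpVM x y : A x -> A y -> A (x^-1 * y).
Proof. by move=> Ax Ay; apply: subgpM => //; exact: subgpV. Qed.

Lemma subgpMr x y : A y -> A (x * y) -> A x.
Proof. by move=> Ay Axy; rewrite -[x](mulgK y); exact: subgpB. Qed.

Lemma subgpI B : subgp B -> subgp (A `&` B).
Proof.
move=> [B1 BB]; split; first by split => //; exact: subgp1.
by move=> x y [Ax Bx] [Ay By]; split; [exact: subgpB|exact: BB].
Qed.

End subgp.

(** * Products, separation and total disconnectedness in topological groups *)

Section topological_group.
Variable G : topologicalGroupType.
Implicit Types (A B U V W O : set G) (x y z : G).

Lemma mulg_cvg (T : Type) (F : set_system T) (FF : Filter F) (f g : T -> G) a b :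
  f @ F --> a -> g @ F --> b -> (fun t => f t * g t) @ F --> a * b.
Proof.
move=> fa gb; apply: (@cvg_comp _ _ _ (fun t => (f t, g t)) (fun p => p.1 * p.2) F
  (nbhs (a, b))); first exact: cvg_pair.
exact: (@mulg_continuous G (a, b)).
Qed.

Lemma mulgl_continuous x : continuous (fun y => x * y).
Proof. by move=> y; apply: mulg_cvg; [exact: cvg_cst|exact: cvg_id]. Qed.

Lemma mulgr_continuous x : continuous (fun y => y * x).
Proof. by move=> y; apply: mulg_cvg; [exact: cvg_id|exact: cvg_cst]. Qed.

Lemma preim_open (T T' : topologicalType) (f : T -> T') (A : set T') :
  continuous f -> open A -> open (f @^-1` A).
Proof. by move=> cf oA; apply: open_comp => // ? _. Qed.

Lemma preim_closed (T T' : topologicalType) (f : T -> T') (A : set T') :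
  continuous f -> closed A -> closed (f @^-1` A).
Proof. by move=> cf oA; apply: preimage_closed => // ? _. Qed.

Lemma image_compact (T T' : topologicalType) (f : T -> T') (A : set T) :
  continuous f -> compact A -> compact (f @` A).
Proof.
by move=> cf cA; apply: continuous_compact => //; exact: continuous_subspaceT.
Qed.

Lemma lcosetE x A : [set x * y | y in A] = (fun y => x^-1 * y) @^-1` A.
Proof.
apply/seteqP; split=> [_ [y Ay <-]|y Ay]; first by rewrite /= mulKg.
by exists (x^-1 * y) => //; rewrite mulVKg.
Qed.

Lemma rcosetE x A : [set y * x | y in A] = (fun y => y / x) @^-1` A.
Proof.
apply/seteqP; split=> [_ [y Ay <-]|y Ay]; first by rewrite /= mulgK.
by exists (y / x) => //; rewrite mulgVK.
Qed.

Lemma lcoset_open x A : open A -> open [set x * y | y in A].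
Proof. by move=> oA; rewrite lcosetE; apply: preim_open oA; exact: mulgl_continuous. Qed.

Lemma rcoset_open x A : open A -> open [set y * x | y in A].
Proof. by move=> oA; rewrite rcosetE; apply: preim_open oA; exact: mulgr_continuous. Qed.

Definition prods A B : set G := [set x * y | x in A & y in B].

Lemma prods_compact A B : compact A -> compact B -> compact (prods A B).
Proof.
move=> cA cB; have -> : prods A B = (fun p : G * G => p.1 * p.2) @` (A `*` B).
  apply/seteqP; split=> [_ [x Ax [y By <-]]|_ [[x y] [Ax By] <-]].
    by exists (x, y).
  by exists x => //; exists y.
by apply: image_compact; [exact: mulg_continuous|exact: compact_setX].
Qed.

Lemma prods_openl A B : open A -> open (prods A B).
Proof.
move=> oA; have -> : prods A B = \bigcup_(y in B) [set x * y | x in A].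
  apply/seteqP; split=> [_ [x Ax [y By <-]]|_ [y By [x Ax <-]]].
    by exists y => //; exists x.
  by exists x => //; exists y.
by apply: bigcup_open => y _; exact: rcoset_open.
Qed.

Lemma prods_openr A B : open B -> open (prods A B).
Proof.
move=> oB; have -> : prods A B = \bigcup_(x in A) [set x * y | y in B].
  apply/seteqP; split=> [_ [x Ax [y By <-]]|_ [x Ax [y By <-]]].
    by exists x => //; exists y.
  by exists x => //; exists y.
by apply: bigcup_open => y _; exact: lcoset_open.
Qed.

(** The near-covering form of compactness makes the neighbourhood of 1 given by continuity at
    [(a, 1)] uniform in [a]. *)
Lemma tube A O : compact A -> open O -> A `<=` O ->
  \forall v \near 1, forall a, A a -> O (a * v).
Proof.
move=> /compact_near_coveringP cA oO AO.
apply: (cA G (nbhs 1) (fun v a => O (a * v))) => a Aa.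
have : (fun p : G * G => p.1 * p.2) @ (a, 1) --> a * 1.
  exact: (@mulg_continuous G (a, 1)).
rewrite mulg1 => /(_ O); apply.
by apply: open_nbhs_nbhs; split=> //; exact: AO.
Qed.

Lemma separate_compact A B : compact A -> closed B -> A `&` B = set0 ->
  exists U V, [/\ open U, open V, A `<=` U, B `<=` V & U `&` V = set0].
Proof.
move=> cA clB AB0.
have : \forall v \near (1 : G), forall a, A a -> (~` B) (a * v).
  apply: tube => //; first exact: closed_openC.
  by move=> a Aa Ba; have : (A `&` B) a by []; rewrite AB0.
(* Division is continuous at (1, 1), so w / v stays in the neighbourhood [nV] for w, v in some open
   [W] around 1. If a w = b v, then b = a (w / v) would lie outside [B]. *)
move=> nV; have : (fun p : G * G => p.1 / p.2) @ (1, 1) --> 1 / 1.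
  apply: mulg_cvg; first exact: cvg_fst.
  by apply: cvg_comp; [exact: cvg_snd|exact: invg_continuous].
rewrite divg1 => /(_ _ nV)[[P Q]] /= [P1 Q1] PQ.
have /nbhs_interior : nbhs 1 (P `&` Q) by exact: filterI.
rewrite nbhsE => -[W [oW W1] WPQ].
exists (prods A W), (prods B W); split.
- exact: prods_openr.
- exact: prods_openr.
- by move=> x Ax; exists x => //; exists 1; rewrite ?mulg1.
- by move=> x Ax; exists x => //; exists 1; rewrite ?mulg1.
- rewrite -subset0 => _ [[a Aa [w Ww <-]] [b Bb [v Wv bvaw]]].
  have /= := PQ (w, v).
  have [Pw _] := interior_subset (WPQ _ Ww).
  have [_ Qv] := interior_subset (WPQ _ Wv).
  move=> /(_ (conj Pw Qv) a Aa); apply.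
  by rewrite mulgA -bvaw mulgK.
Qed.

Hypothesis hG : hausdorff_space G.

(** The intersection [Q] of the relatively clopen subsets of [C] around [x] is connected: a closed
    splitting of [Q] is separated by disjoint open sets [U] and [V], some clopen [E] lies in U ∪ V,
    and its part in [U] is again clopen, so [Q] misses [V]. Hence Q = {x}, and compactness gives an
    [E] inside [O]. *)
Lemma totally_disconnected_base C O x : totally_disconnected [set: G] ->
  compact C -> C x -> open O -> O x ->
  exists E, [/\ E `<=` C, E x, closed E, closed (C `\` E) & E `<=` O].
Proof.
move=> td cC Cx oO Ox.
have clC : closed C by exact: compact_closed.
pose D := [set E | [/\ E `<=` C, E x, closed E & closed (C `\` E)]].
have DC : D C by split => //; rewrite setDv; exact: closed0.
have Dne : D !=set0 by exists C.
have DK A : D A -> closed A /\ A `<=` C by case.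
have Ddir A B : D A -> D B -> exists2 E, D E & E `<=` A `&` B.
  move=> [AC Ax cA cCA] [BC Bx cB cCB]; exists (A `&` B) => //; split.
  - by move=> y [/AC].
  - by [].
  - exact: closedI.
  - by rewrite setDIr; exact: closedU.
set Q := \bigcap_(A in D) A.
have Qx : Q x by move=> A [].
have QC : Q `<=` C by exact: bigcap_inf.
have clQ : closed Q by apply: closed_bigI => A [].
have conQ : connected Q.
  have key P0 P1 : closed P0 -> closed P1 -> P0 `|` P1 = Q -> P0 `&` P1 = set0 ->
      P0 x -> P1 = set0.
    move=> cl0 cl1 P01 P010 P0x.
    have cP0 : compact P0.
      by apply: (subclosed_compact cl0 cC) => y P0y; apply: QC; rewrite -P01; left.
    have [U [V [oU oV PU PV UV]]] := separate_compact cP0 cl1 P010.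
    have [E [EC Ex clE clCE] EUV] : exists2 E, D E & E `<=` U `|` V.
      apply: (@directed_bigcap_sub _ C) => //; first exact: openU.
      by rewrite -/Q -P01 => y [/PU|/PV]; [left|right].
    rewrite -subset0 => y P1y.
    have Qy : Q y by rewrite -P01; right.
    have : (U `&` V) y; last by rewrite UV.
    split; last exact: PV.
    suff /Qy [] : D (E `&` U) by [].
    split.
    - by move=> z [/EC].
    - by split=> //; exact: PU.
    - have -> : E `&` U = E `\` V.
        apply/seteqP; split=> z [Ez].
          move=> Uz; split=> // Vz; have : (U `&` V) z by [].
          by rewrite UV.
        by move=> Vz; split=> //; have [] := EUV _ Ez.
      by apply: closedI => //; exact: open_closedC.
    - by rewrite setDIr; apply: closedU => //; apply: closedI => //; exact: open_closedC.
  move=> B [b Bb] [C1 oC1 BC1] [C2 clC2 BC2].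
  have clB : closed B by rewrite BC2; exact: closedI.
  have clQB : closed (Q `\` B).
    by rewrite BC1 setDIr setDv set0U; apply: closedI => //; exact: open_closedC.
  have BQ : B `<=` Q by rewrite BC1 => y [].
  have [Bx|nBx] := pselect (B x).
    have /seteqP[QB0 _] : Q `\` B = set0.
      by apply: (key B) => //; [exact: setDUK|exact: setDIK].
    apply/seteqP; split=> // y Qy; apply: contrapT => nBy.
    exact: (QB0 y).
  have B0 : B = set0.
    by apply: (key (Q `\` B)) => //; [rewrite setUC; exact: setDUK|rewrite setIC; exact: setDIK].
  by rewrite B0 in Bb.
have [E [EC Ex clE clCE] EO] : exists2 E, D E & E `<=` O.
  apply: (@directed_bigcap_sub _ C) => //.
  move=> y Qy; suff -> : y = x by [].
  have : connected_component [set: G] x y by exists Q.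
  by rewrite td.
by exists E.
Qed.

End topological_group.

(** * Compact open subgroups *)

Section compact_open_subgroups.
Variable G : topologicalGroupType.
Implicit Types (A B U V W O : set G) (x y z : G).

Lemma co_subgp U : compact_open_subgroup U -> subgp U.
Proof. by move=> [sU _ _]; apply/subgp_closed. Qed.

Lemma co_compact U : compact_open_subgroup U -> compact U.
Proof. by case. Qed.

Lemma co_open U : compact_open_subgroup U -> open U.
Proof. by case. Qed.

Lemma open_subgp_closed U : subgp U -> open U -> closed U.
Proof.
move=> sU oU x clUx; have [] := clUx [set x * y | y in U].
  apply: open_nbhs_nbhs; split; first exact: lcoset_open.
  by exists 1; rewrite ?mulg1//; exact: subgp1.
by move=> z [Uz [y Uy xyz]]; apply: (subgpMr sU Uy); rewrite xyz.
Qed.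

Lemma co_closed U : compact_open_subgroup U -> closed U.
Proof. by move=> cU; apply: open_subgp_closed; [exact: co_subgp|exact: co_open]. Qed.

Lemma subgp_nbhs_open U : subgp U -> nbhs 1 U -> open U.
Proof.
move=> sU; rewrite nbhsE => -[W [oW W1] WU].
have -> : U = prods U W; last exact: prods_openr.
apply/seteqP; split=> [x Ux|_ [x Ux [y /WU Uy <-]]]; last exact: subgpM.
by exists x => //; exists 1; rewrite ?mulg1.
Qed.

Lemma co_subset U V : compact_open_subgroup U -> subgp V -> open V -> V `<=` U ->
  compact_open_subgroup V.
Proof.
move=> cU sV oV VU; split=> //; first by apply: (iffLR (subgp_closed _)).
by apply: (subclosed_compact _ (co_compact cU)) => //; exact: open_subgp_closed.
Qed.

Lemma co_preim (f : G -> G) U V : {morph f : x y / x * y} -> continuous f ->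
  compact_open_subgroup U -> compact_open_subgroup V ->
  compact_open_subgroup (U `&` f @^-1` V).
Proof.
move=> fM cf cU cV; apply: (co_subset cU); last by move=> x [].
- have f1 : f 1 = 1 by apply: (@mulgI _ (f 1)); rewrite -fM !mulg1.
  have fV x : f x^-1 = (f x)^-1 by apply: (@mulgI _ (f x)); rewrite -fM !mulgV.
  apply: subgpI; first exact: co_subgp.
  split; first by rewrite /= f1; apply: subgp1; exact: co_subgp.
  by move=> x y /= Vx Vy; rewrite fM fV; apply: subgpB => //; exact: co_subgp.
- by apply: openI; [exact: co_open|apply: preim_open => //; exact: co_open].
Qed.

Lemma coI U V : compact_open_subgroup U -> compact_open_subgroup V ->
  compact_open_subgroup (U `&` V).
Proof. by apply: (@co_preim idfun) => // x; exact: cvg_id. Qed.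

(** Requiring both [v] and its inverse makes the condition symmetric: for [A = O] this is the
    subgroup of all [v] with A v = A. It is used again with [O] larger than [A]. *)
Definition stabilizer A O : set G :=
  [set v | forall a, A a -> O (a * v) /\ O (a / v)].

Lemma stabilizer_nbhs A O : compact A -> open O -> A `<=` O ->
  nbhs 1 (stabilizer A O).
Proof.
move=> cA oO AO; have nE := tube cA oO AO.
have nE' : \forall v \near (1 : G), forall a, A a -> O (a / v).
  have := @invg_continuous G 1; rewrite /continuous_at invg1.
  by move=> /(_ [set v | forall a, A a -> O (a * v)]); exact.
by apply: filterS2 nE nE' => v Ev Ev' a Aa; split; [exact: Ev|exact: Ev'].
Qed.

(** [U] is the right stabilizer of a compact open set [E] with 1 ∈ E ⊆ O: acting on 1 shows U ⊆ E,
    and compactness of [E] makes [U] open. *)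
Lemma van_dantzig O : hausdorff_space G -> totally_disconnected [set: G] ->
  locally_compact [set: G] -> open O -> O 1 ->
  exists2 U, compact_open_subgroup U & U `<=` O.
Proof.
move=> hG td lc oO O1; have [C] := lc 1 I; rewrite withinET => nC [cC clC].
have [|||E [EC E1 clE clCE EO]] := @totally_disconnected_base G hG C (O `&` C^°) 1 td cC.
- exact: nbhs_singleton.
- by apply: openI => //; exact: open_interior.
- by split=> //; exact: nbhs_singleton (nbhs_interior nC).
have cE : compact E by exact: (subclosed_compact _ cC).
(* [E] is only clopen relative to [C]; it is open in [G] because it lies in the interior of [C]. *)
have oE : open E.
  have -> : E = C^° `&` ~` (C `\` E).
    apply/seteqP; split=> [x Ex|x [/interior_subset Cx nCEx]].
      by split; [exact: (EO _ Ex).2|case].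
    by apply: contrapT => nEx; apply: nCEx.
  by apply: openI; [exact: open_interior|exact: closed_openC].
pose U := stabilizer E E.
have sU : subgp U.
  split=> [a Ea|x y Ux Uy a Ea]; first by rewrite divg1 mulg1.
  rewrite invgF !mulgA; split.
    by apply: (Uy _ _).2; exact: (Ux _ _).1.
  by apply: (Ux _ _).2; exact: (Uy _ _).1.
have UE : U `<=` E by move=> v /(_ _ E1)[]; rewrite mul1g.
have oU : open U by apply: subgp_nbhs_open => //; exact: stabilizer_nbhs.
exists U; last by move=> x /UE /EO[].
split=> //; first by apply: (iffLR (subgp_closed _)).
by apply: (subclosed_compact _ cE) => //; exact: open_subgp_closed.
Qed.

Lemma compact_finite_nbhs A (P : G -> set G) : compact A ->
  (forall x, A x -> open (P x) /\ P x x) ->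
  exists2 s : seq G, (forall x, x \in s -> A x) &
    forall y, A y -> exists2 x, x \in s & P x y.
Proof.
rewrite compact_cover => cA AP.
have [|D DA AD] := cA G A P (fun x Ax => (AP x Ax).1).
  by move=> x Ax; exists x => //; exact: (AP x Ax).2.
exists (enum_fset D); first by move=> x xD; apply: set_mem; exact: DA.
by move=> y /AD[x xD Pxy]; exists x.
Qed.

(** A [packing] bounds an index from below by [n], a [transversal] computes it. Only the values of
    [g] below [n] matter. *)
Definition packing A B (n : nat) (g : nat -> G) :=
  (forall i, (i < n)%N -> A (g i)) /\
  forall i j, (i < n)%N -> (j < n)%N -> B ((g i)^-1 * g j) -> i = j.

Definition transversal A B (n : nat) (g : nat -> G) :=
  packing A B n g /\ forall x, A x -> exists2 i, (i < n)%N & B ((g i)^-1 * x).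

Lemma irredundant B (s : seq G) : subgp B -> exists s' : seq G,
  [/\ {subset s' <= s},
      forall i j, (i < size s')%N -> (j < size s')%N ->
        B ((nth 1 s' i)^-1 * nth 1 s' j) -> i = j &
      forall x, x \in s -> exists2 y, y \in s' & B (y^-1 * x)].
Proof.
move=> sB; elim: s => [|x s [s' [s's pk cov]]].
  by exists [::]; split.
have [[y ys' Byx]|nx] := pselect (exists2 y, y \in s' & B (y^-1 * x)).
  exists s'; split=> //; first by move=> z /s's zs; rewrite inE zs orbT.
  by move=> z; rewrite inE => /orP[/eqP ->|/cov//]; exists y.
exists (x :: s'); split.
- by move=> z; rewrite !inE => /orP[->//|/s's ->]; rewrite orbT.
- move=> [|i] [|j] //= si sj Bij.
  + exfalso; apply: nx; exists (nth 1 s' j); first exact: mem_nth.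
    by move/(subgpV sB): Bij; rewrite invgM invgK.
  + by exfalso; apply: nx; exists (nth 1 s' i) => //; exact: mem_nth.
  + by congr _.+1; apply: pk.
- move=> z; rewrite inE => /orP[/eqP ->|/cov[y ys Byz]].
    by exists x; rewrite ?mem_head// mulVg; exact: subgp1.
  by exists y => //; rewrite inE ys orbT.
Qed.

Lemma transversal_exists A B : compact A -> subgp B -> open B ->
  exists n g, transversal A B n g.
Proof.
move=> cA sB oB.
have [|s sA cov] := @compact_finite_nbhs A (fun x => [set x * y | y in B]) cA.
  move=> x _; split; first exact: lcoset_open.
  by exists 1; rewrite ?mulg1//; exact: subgp1.
have [s' [s's pk cov']] := irredundant s sB.
exists (size s'), (nth 1 s'); split; first split=> //.
  by move=> i si; apply/sA/s's; exact: mem_nth.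
move=> x /cov[y /cov'[z zs' Bzy] [b Bb bx]].
exists (index z s'); first by rewrite index_mem.
by rewrite nth_index// -bx mulgA; exact: subgpM.
Qed.

(** Passes from a bijection with the set of cosets to explicit representatives, the form in which
    indices are compared with Haar measures. *)
Lemma has_indexP A B n : subgp A -> subgp B -> B `<=` A ->
  has_index A B n <-> exists g, transversal A B n g.
Proof.
move=> sA sB BA; split.
  rewrite /has_index card_eq_sym => /card_set_bijP[f [fim finj fsur]].
  have /choice[g gP] : forall i : nat, exists x, (i < n)%N ->
      A x /\ f i = [set x * b | b in B].
    move=> i; have [ni|_] := boolP (i < n)%N; last by exists 1.
    by have [x Ax xfi] := fim i ni; exists x.
  exists g; split; first split.
  - by move=> i /gP[].
  - move=> i j ni nj Bij; apply: finj; rewrite ?inE//=.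
    have [_ ->] := gP i ni; have [_ ->] := gP j nj.
    apply/seteqP; split=> _ [b Bb <-].
      exists ((g j)^-1 * g i * b); last by rewrite -mulgA mulVKg.
      apply: subgpM => //; rewrite -[X in _ * X]invgK -invgM.
      exact: subgpV.
    exists ((g i)^-1 * g j * b); last by rewrite -mulgA mulVKg.
    exact: subgpM.
  - move=> x Ax; have [|i ni fix_] := fsur [set x * b | b in B]; first by exists x.
    exists i => //; have [_ fi] := gP i ni.
    have : [set g i * b | b in B] x.
      by rewrite -fi fix_; exists 1; rewrite ?mulg1//; exact: subgp1.
    by move=> [b Bb <-]; rewrite mulKg.
move=> [g [[gA pk] cov]]; rewrite /has_index card_eq_sym.
apply/card_set_bijP; exists (fun i => [set g i * b | b in B]); split.
- by move=> i ni; exists (g i) => //; exact: gA.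
- move=> i j /set_mem ni /set_mem nj gij; apply: pk => //.
  have : [set g i * b | b in B] (g j).
    by rewrite gij; exists 1; rewrite ?mulg1//; exact: subgp1.
  by move=> [b Bb <-]; rewrite mulKg.
- move=> _ [x Ax <-]; have [i ni Bix] := cov x Ax; exists i => //.
  apply/seteqP; split=> _ [b Bb <-].
    exists (x^-1 * g i * b); last by rewrite -mulgA mulVKg.
    by apply: subgpM => //; rewrite -[X in _ * X]invgK -invgM; exact: subgpV.
  exists ((g i)^-1 * x * b); last by rewrite -mulgA mulVKg.
  exact: subgpM.
Qed.

End compact_open_subgroups.

(** * Haar measure and indices *)

Section haar.
Variables (R : realType) (G : topologicalGroupType).
Variable mu : {measure set (borel_type G) -> \bar R}.
Hypothesis hG : hausdorff_space G.
Hypothesis mu_haar : is_left_haar mu.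
Implicit Types (A B U V : set G).

Lemma open_measurable_borel U : open U -> measurable (U : set (borel_type G)).
Proof. exact: sub_sigma_algebra. Qed.

Lemma compact_measurable_borel U : compact U -> measurable (U : set (borel_type G)).
Proof.
move=> cU; rewrite -[U]setCK; apply: measurableC; apply: open_measurable_borel.
by apply: closed_openC; exact: compact_closed.
Qed.

Lemma haar_lcoset x U : open U -> mu [set x * y | y in U] = mu U.
Proof. by move=> oU; apply: (haar_left_invariant mu_haar x (open_measurable_borel oU)). Qed.

(** If [U] were null, so would be every compact set, being covered by finitely many translates of
    [U], and then all of [G] by inner regularity. *)
Lemma haar_co_neq0 U : compact_open_subgroup U -> mu U <> 0%E.
Proof.
move=> cU U0; apply: (haar_neq0 mu_haar); have oU := co_open cU.
rewrite (haar_inner_regular mu_haar); last exact: openT.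
apply/eqP; rewrite eq_le; apply/andP; split; last first.
  by apply: ereal_sup_ubound; exists set0; [split; first exact: compact0|rewrite measure0].
apply: ge_ereal_sup => _ [K [cK _] <-].
have [|s sK cov] := @compact_finite_nbhs _ K (fun x => [set x * y | y in U]) cK.
  move=> x _; split; first exact: lcoset_open.
  by exists 1; rewrite ?mulg1//; exact: subgp1 (co_subgp cU).
have mW (t : seq G) : measurable
    (\big[setU/set0]_(x <- t) [set x * y | y in U] : set (borel_type G)).
  apply: bigsetU_measurable => x _; apply: open_measurable_borel.
  exact: lcoset_open.
have W0 (t : seq G) : mu (\big[setU/set0]_(x <- t) [set x * y | y in U]) = 0%E.
  elim: t => [|x t IH]; first by rewrite big_nil measure0.
  rewrite big_cons measureU0 ?haar_lcoset//.
  by apply: open_measurable_borel; exact: lcoset_open.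
rewrite -(W0 s); apply: le_measure; rewrite ?inE//.
  exact: compact_measurable_borel.
move=> y /cov[x xs xUy]; rewrite -bigcup_seq.
by exists x.
Qed.

Definition haar_size U : R := fine (mu U).

Lemma haar_sizeE U : compact_open_subgroup U -> mu U = (haar_size U)%:E.
Proof.
move=> cU; rewrite /haar_size fineK// ge0_fin_numE//.
by apply: (haar_compact mu_haar); exact: co_compact.
Qed.

Lemma haar_size_gt0 U : compact_open_subgroup U -> (0 < haar_size U)%R.
Proof.
move=> cU; rewrite -lte_fin -haar_sizeE// lt0e measure_ge0 andbT.
exact/eqP/haar_co_neq0.
Qed.

Lemma haar_size_le U V : compact_open_subgroup U -> compact_open_subgroup V ->
  U `<=` V -> (haar_size U <= haar_size V)%R.
Proof.
move=> cU cV UV; rewrite -lee_fin -!haar_sizeE//.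
by apply: le_measure; rewrite ?inE//; apply: open_measurable_borel; exact: co_open.
Qed.

Section packing.
Variables (A B : set G) (cA : compact_open_subgroup A).
Hypotheses (cB : compact_open_subgroup B) (BA : B `<=` A).

Let blocks n (g : nat -> G) i := if (i < n)%N then [set g i * b | b in B] else set0.

Lemma packing_measure n g : packing A B n g ->
  mu (\big[setU/set0]_(i < n) blocks n g i) = (n%:R * haar_size B)%:E.
Proof.
move=> [gA pk]; rewrite measure_bigsetU.
- transitivity (\sum_(i < n) (haar_size B)%:E)%E.
    apply: eq_bigr => i _; rewrite /blocks ltn_ord -haar_sizeE//.
    by apply: haar_lcoset; exact: co_open.
  by rewrite sumEFin sumr_const card_ord mulr_natl.
- move=> i; rewrite /blocks; case: ifP => // _.
  by apply: open_measurable_borel; apply: lcoset_open; exact: co_open.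
- move=> i j _ _ [x []]; rewrite /blocks; case: ifP => // ni [b Bb <-].
  case: ifP => // nj [c Bc gji]; apply: pk => //.
  have -> : (g i)^-1 * g j = b / c.
    apply: (@mulgI _ (g i)); apply: (@mulIg _ c).
    by rewrite mulVKg gji mulgA mulgVK.
  by apply: subgpB => //; exact: co_subgp.
Qed.

Lemma packing_subset n g : packing A B n g ->
  \big[setU/set0]_(i < n) blocks n g i `<=` A.
Proof.
move=> [gA pk] x; rewrite -(bigcup_mkord n (blocks n g)) => -[i /= ni].
rewrite /blocks ni => -[b Bb <-].
by apply: subgpM; [exact: co_subgp|exact: gA|exact: BA].
Qed.

Lemma packing_le n g : packing A B n g ->
  (n%:R * haar_size B <= haar_size A)%R.
Proof.
move=> pk; rewrite -lee_fin -haar_sizeE// -(packing_measure pk).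
apply: le_measure; rewrite ?inE; last exact: packing_subset.
- apply: bigsetU_measurable => i _; rewrite /blocks ltn_ord.
  by apply: open_measurable_borel; apply: lcoset_open; exact: co_open.
- by apply: open_measurable_borel; exact: co_open.
Qed.

Lemma transversal_size n g : transversal A B n g ->
  haar_size A = (n%:R * haar_size B)%R.
Proof.
move=> [pk cov]; apply/EFin_inj; rewrite -haar_sizeE// -(packing_measure pk).
congr (mu _); apply/seteqP; split; last exact: packing_subset.
move=> x /cov[i ni Bix]; rewrite -(bigcup_mkord n (blocks n g)).
exists i => //; rewrite /blocks ni; exists ((g i)^-1 * x) => //.
by rewrite mulVKg.
Qed.

(** A missed coset would extend the packing to n + 1 disjoint translates of [B], too many for the
    measure of [A]. *)
Lemma packing_covers n g : packing A B n g ->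
  haar_size A = (n%:R * haar_size B)%R -> transversal A B n g.
Proof.
move=> pk AnB; split=> // x Ax; apply: contrapT => nx.
have : packing A B n.+1 (fun i => if (i < n)%N then g i else x).
  case: pk => gA pk; split=> [i _|i j].
    by case: ifP => // /gA.
  rewrite !ltnS; case: ltnP => [ni _|ni]; case: ltnP => [nj _|nj].
  - exact: pk ni nj.
  - by move=> _ Bij; exfalso; apply: nx; exists i.
  - move=> _ Bij; exfalso; apply: nx; exists j => //.
    by move/(subgpV (co_subgp cB)): Bij; rewrite invgM invgK.
  - by move=> ni' nj' _; apply/eqP; rewrite eqn_leq (leq_trans ni')// (leq_trans nj').
move=> /packing_le; rewrite AnB; apply/negP; rewrite -ltNge.
by rewrite ltr_pM2r ?haar_size_gt0// ltr_nat.
Qed.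

End packing.

(** [f] induces an injection of the cosets of A ∩ f^-1 B in [A] into the cosets of [B] in [U]. The
    bound [q] on the index is a ratio of Haar measures, so it need not be an integer. *)
Lemma index_preim (f : G -> G) A U B (q : R) :
  {morph f : x y / x * y} -> continuous f ->
  compact_open_subgroup A -> compact_open_subgroup U -> compact_open_subgroup B ->
  B `<=` U -> (forall x, A x -> U (f x)) -> (haar_size U <= q * haar_size B)%R ->
  (haar_size A <= q * haar_size (A `&` f @^-1` B))%R.
Proof.
move=> fM cf cA cU cB BU AU Uq.
have cP : compact_open_subgroup (A `&` f @^-1` B) by exact: co_preim.
have [n [g tr]] := transversal_exists (co_compact cA) (co_subgp cP) (co_open cP).
have PA : A `&` f @^-1` B `<=` A by move=> x [].
rewrite (transversal_size cA cP PA tr) ler_pM2r ?haar_size_gt0//.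
have f1 : f 1 = 1 by apply: (@mulgI _ (f 1)); rewrite -fM !mulg1.
have fV x : f x^-1 = (f x)^-1 by apply: (@mulgI _ (f x)); rewrite -fM !mulgV.
have : packing U B n (f \o g).
  case: tr => -[gA pk] _; split=> [i /gA /AU//|i j ni nj Bij].
  apply: pk => //; split; last by rewrite /= fM fV.
  by apply: subgpVM; [exact: co_subgp|exact: gA|exact: gA].
move=> /(packing_le cU cB BU) /le_trans /(_ Uq).
by rewrite ler_pM2r ?haar_size_gt0.
Qed.

Lemma index_restrict A U B (q : R) :
  compact_open_subgroup A -> compact_open_subgroup U -> compact_open_subgroup B ->
  B `<=` U -> A `<=` U -> (haar_size U <= q * haar_size B)%R ->
  (haar_size A <= q * haar_size (A `&` B))%R.
Proof.
move=> cA cU cB BU AU; apply: (@index_preim idfun) => // x.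
exact: cvg_id.
Qed.

End haar.

(** * Cotrajectories and the scale *)

Section cotrajectories.
Variables (G : topologicalGroupType) (phi : G -> G).
Hypotheses (phiM : {morph phi : x y / x * y}) (phi_cont : continuous phi).
Implicit Types (A B U V : set G).

Lemma cotrajectoryP U n x :
  cotrajectory phi U n x <-> forall i, (i <= n)%N -> U (iter i phi x).
Proof. by split=> H i ni; apply: H. Qed.

Lemma cotrajectory0 U : cotrajectory phi U 0 = U.
Proof.
apply/seteqP; split=> x; first by move=> /cotrajectoryP /(_ 0%N); exact.
by move=> Ux; apply/cotrajectoryP => i; rewrite leqn0 => /eqP ->.
Qed.

Lemma cotrajectoryD U m n x : cotrajectory phi U (m + n) x <->
  cotrajectory phi U m x /\ cotrajectory phi U n (iter m phi x).
Proof.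
split=> [/cotrajectoryP H|[/cotrajectoryP H1 /cotrajectoryP H2]].
  split; apply/cotrajectoryP => i ni; first by apply: H; rewrite (leq_trans ni)// leq_addr.
  by rewrite -iterD addnC; apply: H; rewrite leq_add2l.
apply/cotrajectoryP => i imn; have [|mi] := leqP i m; first exact: H1.
rewrite -(subnK (ltnW mi)) iterD; apply: H2.
by rewrite leq_subLR.
Qed.

Lemma cotrajectoryS U n :
  cotrajectory phi U n.+1 = cotrajectory phi U n `&` iter n.+1 phi @^-1` U.
Proof.
apply/seteqP; split=> x.
  by move=> /cotrajectoryP H; split; [apply/cotrajectoryP => i ni|]; apply: H => //; exact: leqW.
move=> [/cotrajectoryP H Hn]; apply/cotrajectoryP => i.
by rewrite leq_eqVlt => /orP[/eqP ->//|]; rewrite ltnS; exact: H.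
Qed.

Lemma cotrajectory1 U : cotrajectory phi U 1 = U `&` phi @^-1` U.
Proof. by rewrite cotrajectoryS cotrajectory0. Qed.

Lemma cotrajectory_cotrajectory1 U n :
  cotrajectory phi (cotrajectory phi U n) 1 = cotrajectory phi U n.+1.
Proof.
rewrite cotrajectory1; apply/seteqP; split=> x.
  move=> [Un U1]; rewrite -add1n; apply/cotrajectoryD; split=> //.
  apply/cotrajectoryP => i; case: i => [|[|//]] _.
    by move/cotrajectoryP: Un => /(_ 0%N); exact.
  by move/cotrajectoryP: U1 => /(_ 0%N); exact.
move=> Un; split; first by move: Un; rewrite -addn1 => /cotrajectoryD[].
by move: Un; rewrite -add1n => /cotrajectoryD[].
Qed.

Lemma cotrajectory_le U m n : (m <= n)%N ->
  cotrajectory phi U n `<=` cotrajectory phi U m.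
Proof.
move=> mn x /cotrajectoryP H; apply/cotrajectoryP => i im.
by apply: H; exact: leq_trans mn.
Qed.

Lemma cotrajectory_sub U n : cotrajectory phi U n `<=` U.
Proof. by rewrite -{2}(cotrajectory0 U); exact: cotrajectory_le. Qed.

Lemma cotrajectory_mono U V n : U `<=` V -> cotrajectory phi U n `<=` cotrajectory phi V n.
Proof.
move=> UV x /cotrajectoryP H; apply/cotrajectoryP => i ni; exact/UV/H.
Qed.

Lemma cotrajectoryI U V n :
  cotrajectory phi (U `&` V) n = cotrajectory phi U n `&` cotrajectory phi V n.
Proof.
apply/seteqP; split=> x.
  by move=> /cotrajectoryP H; split; apply/cotrajectoryP => i /H[].
move=> [/cotrajectoryP HU /cotrajectoryP HV]; apply/cotrajectoryP => i ni.
by split; [exact: HU|exact: HV].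
Qed.

Lemma iter_morph n : {morph iter n phi : x y / x * y}.
Proof. by elim: n => [//|n IH] x y /=; rewrite IH phiM. Qed.

Lemma iter_continuous n : continuous (iter n phi).
Proof.
elim: n => [|n IH] x; first exact: cvg_id.
by apply: continuous_comp; [exact: IH|exact: phi_cont].
Qed.

Lemma morph1 (f : G -> G) : {morph f : x y / x * y} -> f 1 = 1.
Proof. by move=> fM; apply: (@mulgI _ (f 1)); rewrite -fM !mulg1. Qed.

Lemma morphV (f : G -> G) : {morph f : x y / x * y} -> {morph f : x / x^-1}.
Proof. by move=> fM x; apply: (@mulgI _ (f x)); rewrite -fM !mulgV morph1. Qed.

Lemma co_cotrajectory U n : compact_open_subgroup U ->
  compact_open_subgroup (cotrajectory phi U n).
Proof.
move=> cU; elim: n => [|n IH]; first by rewrite cotrajectory0.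
rewrite cotrajectoryS; apply: co_preim => //; first exact: iter_morph.
exact: iter_continuous.
Qed.

Lemma subgp_image A : subgp A -> subgp (phi @` A).
Proof.
move=> sA; split; first by exists 1; [exact: subgp1|exact: morph1].
move=> _ _ [x Ax <-] [y Ay <-]; exists (x / y); first exact: subgpB.
by rewrite phiM morphV.
Qed.

(** For [x] in [U], [x] is in U_{-1} exactly when [phi x] is in U ∩ phi U; so [phi] carries coset
    representatives to coset representatives, and they lift back. *)
Lemma displacement_indexP U k : subgp U ->
  displacement_index phi U k <->
  exists g, transversal U (cotrajectory phi U 1) k g.
Proof.
move=> sU; rewrite /displacement_index has_indexP; first last.
- by move=> x [].
- by apply: subgpI => //; exact: subgp_image.
- exact: subgp_image.
rewrite cotrajectory1; split=> -[g [[gA pk] cov]].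
  have /choice[h hP] : forall i : nat, exists x, (i < k)%N -> U x /\ phi x = g i.
    move=> i; have [ki|_] := boolP (i < k)%N; last by exists 1.
    by have [x Ux xg] := gA i ki; exists x.
  exists h; split; first split=> [i /hP[]//|i j ki kj [_ Bij]].
    apply: pk => //; have [Ui <-] := hP i ki; have [Uj <-] := hP j kj.
    rewrite -morphV// -phiM; split=> //.
    by exists ((h i)^-1 * h j) => //; exact: subgpVM.
  move=> x Ux; have [|i ki [Uix _]] := cov (phi x); first by exists x.
  exists i => //; have [Ui gi] := hP i ki; split; first exact: subgpVM.
  by rewrite /= phiM morphV// gi.
exists (phi \o g); split; first split=> [i /gA Ui|i j ki kj].
- by exists (g i).
- rewrite /= -morphV// -phiM => -[Uij _]; apply: pk => //; split=> //.
  by apply: subgpVM => //; exact: gA.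
- move=> _ [x Ux <-]; have [i ki [Uix pUix]] := cov x Ux.
  exists i => //; rewrite /= -morphV// -phiM; split=> //.
  by exists ((g i)^-1 * x).
Qed.

Lemma displacement_index_exists U : compact_open_subgroup U ->
  exists k, displacement_index phi U k.
Proof.
move=> cU; have cU1 := co_cotrajectory 1 cU.
have [k gP] := transversal_exists (co_compact cU) (co_subgp cU1) (co_open cU1).
by exists k; apply/displacement_indexP => //; exact: co_subgp.
Qed.

(** The given [U] has some displacement index, so a least one exists and [xget] does not return its
    default value 0. *)
Lemma scaleP U : compact_open_subgroup U ->
  displacement_indices phi (scale phi) /\
  forall m, displacement_indices phi m -> (scale phi <= m)%N.
Proof.
move=> cU; have [k kP] := displacement_index_exists cU.
rewrite /scale; apply: (@xgetPex _ 0%N [set n | displacement_indices phi n /\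
  forall m, displacement_indices phi m -> (n <= m)%N]).
have ex : exists n, `[< displacement_indices phi n >].
  by exists k; apply/asboolP; exists U.
case: (ex_minnP ex) => n /asboolP nD nmin; exists n; split=> // m mD.
by apply: nmin; exact/asboolP.
Qed.

End cotrajectories.

Section scale_haar.
Variables (R : realType) (G : topologicalGroupType).
Variable mu : {measure set (borel_type G) -> \bar R}.
Hypothesis hG : hausdorff_space G.
Hypothesis mu_haar : is_left_haar mu.
Variable phi : G -> G.
Hypotheses (phiM : {morph phi : x y / x * y}) (phi_cont : continuous phi).
Implicit Types (A B U V : set G).
Local Notation hs := (haar_size mu).
Local Notation cot := (cotrajectory phi).

Lemma haar_size_double A B x : compact_open_subgroup A -> compact_open_subgroup B ->
  B `<=` A -> A x -> ~ B x -> (2 * hs B <= hs A)%R.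
Proof.
move=> cA cB BA Ax nBx.
apply: (@packing_le _ _ mu mu_haar A B cA cB BA 2 (fun i => if i == 0%N then 1 else x)).
split=> [[|[|//]] _ //=|]; first exact: subgp1 (co_subgp cA).
move=> [|[|//]] [|[|//]] //= _ _; rewrite ?mulg1 ?invg1 ?mul1g => Bx; exfalso; apply: nBx => //.
by rewrite -[x]invgK; exact: (subgpV (co_subgp cB)).
Qed.

Lemma displacement_haar U k : compact_open_subgroup U -> displacement_index phi U k ->
  hs U = (k%:R * hs (cot U 1))%R.
Proof.
move=> cU /(displacement_indexP phiM _ (co_subgp cU))[g tr].
apply: transversal_size tr => //; first exact: co_cotrajectory.
exact: cotrajectory_sub.
Qed.

Lemma scale_gt0 U : compact_open_subgroup U -> (0 < scale phi)%N.
Proof.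
move=> /(scaleP phiM phi_cont)[[V cV /(displacement_haar cV) E] _].
have := haar_size_gt0 hG mu_haar cV; rewrite lt0n E; apply: contraTneq => ->.
by rewrite mul0r ltxx.
Qed.

Lemma scale_le U : compact_open_subgroup U ->
  ((scale phi)%:R * hs (cot U 1) <= hs U)%R.
Proof.
move=> cU; have [k kP] := displacement_index_exists phiM phi_cont cU.
rewrite [leRHS](displacement_haar cU kP) ler_pM2r; last first.
  by apply: haar_size_gt0 => //; exact: co_cotrajectory.
rewrite ler_nat; apply: (scaleP phiM phi_cont cU).2.
by exists U.
Qed.

(** The displacement index is an integer at least s, so being less than s + 1 forces it to be s.
    Thus a strict estimate of measures proves minimality. *)
Lemma minimizingP U : compact_open_subgroup U ->
  minimizing phi U <-> (hs U < (scale phi).+1%:R * hs (cot U 1))%R.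
Proof.
move=> cU; have cU1 := co_cotrajectory phiM phi_cont 1 cU.
split=> [[_ /(displacement_haar cU) ->]|].
  by rewrite ltr_pM2r ?haar_size_gt0// ltr_nat.
have [k kP] := displacement_index_exists phiM phi_cont cU.
rewrite (displacement_haar cU kP) ltr_pM2r ?haar_size_gt0// ltr_nat ltnS => ks.
split=> //; suff <- : k = scale phi by [].
apply/eqP; rewrite eqn_leq ks; apply: (scaleP phiM phi_cont cU).2.
by exists U.
Qed.

Lemma haar_size_cotrajectory U n : compact_open_subgroup U ->
  ((scale phi)%:R ^+ n * hs (cot U n) <= hs U)%R.
Proof.
move=> cU; elim: n => [|n IH]; first by rewrite cotrajectory0 expr0 mul1r.
apply: le_trans IH; rewrite exprSr -mulrA ler_wpM2l ?exprn_ge0//.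
rewrite -cotrajectory_cotrajectory1; apply: scale_le.
exact: co_cotrajectory.
Qed.

(** U_{-n-1} is the part of U_{-n} that phi^n sends into U_{-1}, so its index in U_{-n} is at most
    [U : U_{-1}] = s. *)
Lemma minimizing_cotrajectory U n : minimizing phi U -> minimizing phi (cot U n).
Proof.
move=> mU; have [cU dU] := mU; apply/minimizingP; first exact: co_cotrajectory.
rewrite cotrajectory_cotrajectory1.
apply: (@le_lt_trans _ _ ((scale phi)%:R * hs (cot U n.+1))%R); last first.
  by rewrite ltr_pM2r ?ltr_nat// haar_size_gt0//; exact: co_cotrajectory.
have -> : (cot U n.+1) = (cot U n) `&` iter n phi @^-1` (cot U 1).
  by rewrite -addn1; apply/seteqP; split=> x /cotrajectoryD.
apply: (index_preim hG mu_haar (U := U)).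
- exact: iter_morph.
- exact: iter_continuous.
- exact: co_cotrajectory.
- by [].
- exact: co_cotrajectory.
- exact: cotrajectory_sub.
- by move=> x /cotrajectoryP; exact.
- by rewrite (displacement_haar cU dU).
Qed.

Lemma minimizing_haar U n : minimizing phi U ->
  hs U = ((scale phi)%:R ^+ n * hs (cot U n))%R.
Proof.
move=> mU; elim: n => [|n IH]; first by rewrite cotrajectory0 expr0 mul1r.
have [cUn /(displacement_haar cUn) E] := minimizing_cotrajectory n mU.
by rewrite IH E cotrajectory_cotrajectory1 mulrA exprSr.
Qed.

(** A minimizing [U] contains U_{-1}, which is again minimizing and is mapped into [U] by [phi]. *)
Lemma nub_stable x : nub phi x -> nub phi (phi x).
Proof.
move=> Nx U mU.
have [/cotrajectoryP H] : ((cot U 1) `&` setT) x.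
  by split=> //; apply: Nx; exact: minimizing_cotrajectory.
by move=> _; exact: (H 1%N).
Qed.

End scale_haar.

Section finite_cosets.
Variable G : topologicalGroupType.
Implicit Types (A D U V : set G).

(** Compactness of [D] gives finitely many cosets of [U]; their representatives are then moved into
    [A], which itself need not be closed. *)
Lemma finite_rcoset_reps A D U : subgp U -> open U -> compact D -> A `<=` D ->
  A 1 -> exists2 s : seq G, (forall l, l \in s -> A l) &
    forall x, A x -> exists2 l, l \in s & U (x / l).
Proof.
move=> sU oU cD AD A1.
have [|t tD cov] := @compact_finite_nbhs _ D (fun x => [set y * x | y in U]) cD.
  move=> x _; split; first exact: rcoset_open.
  by exists 1; rewrite ?mul1g//; exact: subgp1.
(* [c x] is a point of [A] in the coset of [x]; the value 1 serves the cosets that miss [A]. *)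
have /choice[c cP] : forall x : G, exists c, A c /\
    ((exists2 z, A z & U (z / x)) -> U (c / x)).
  move=> x; have [[z Az Uzx]|nz] := pselect (exists2 z, A z & U (z / x)).
    by exists z.
  by exists 1; split=> // /nz.
exists (map c t); first by move=> _ /mapP[x _ ->]; exact: (cP x).1.
move=> z Az; have [x xt [u Uu uxz]] := cov z (AD z Az).
exists (c x); first exact: map_f.
have Uzx : U (z / x) by rewrite -uxz mulgK.
have /subgpB-/(_ _ _ Uzx) : subgp U by [].
move=> /(_ (c x / x)); rewrite mulgKA; apply; apply: (cP x).2.
by exists z.
Qed.

End finite_cosets.

(** * Homoclinic points *)

Section trajectories.
Variables (G : topologicalGroupType) (phi : G -> G).
Hypothesis hG : hausdorff_space G.
Hypotheses (phiM : {morph phi : x y / x * y}) (phi_cont : continuous phi).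
Implicit Types (A B U V : set G).
Local Notation cot := (cotrajectory phi).

(* U_+ consists of the endpoints of infinite backward trajectories in U, and
   U_- of the starting points of infinite forward trajectories in U. *)
Definition plus U := \bigcap_n (iter n phi @` cot U n).
Definition minus U := \bigcap_n (cot U n).

Lemma minusP U x : minus U x <-> forall i, U (iter i phi x).
Proof.
split=> H i; first by have /cotrajectoryP/(_ i) := H i I; exact.
by move=> _; apply/cotrajectoryP => j _; exact: H.
Qed.

Lemma minus_iter U i x : minus U x -> minus U (iter i phi x).
Proof. by move=> /minusP H; apply/minusP => j; rewrite -iterD; exact: H. Qed.

Lemma subgp_iter_image n A : subgp A -> subgp (iter n phi @` A).
Proof. by move=> sA; apply: subgp_image => //; exact: iter_morph. Qed.

Lemma subgp_bigcap (I : Type) (D : set I) (F : I -> set G) :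
  (forall i, D i -> subgp (F i)) -> subgp (\bigcap_(i in D) F i).
Proof.
move=> sF; split=> [i Di|x y Fx Fy i Di]; first exact: subgp1 (sF i Di).
by apply: (subgpB (sF i Di)); [exact: Fx|exact: Fy].
Qed.

Section one_subgroup.
Variables (U : set G) (cU : compact_open_subgroup U).

Let sU : subgp U. Proof. exact: co_subgp. Qed.

Let sP : subgp (plus U).
Proof.
apply: subgp_bigcap => n _; apply: subgp_iter_image; apply: co_subgp.
exact: co_cotrajectory.
Qed.

Let sM : subgp (minus U).
Proof. by apply: subgp_bigcap => n _; apply: co_subgp; exact: co_cotrajectory. Qed.

Lemma plus_sub : plus U `<=` U.
Proof. by move=> x /(_ 0%N I)[y]; rewrite cotrajectory0 /= => Uy <-. Qed.

Lemma minus_sub : minus U `<=` U.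
Proof. by move=> x /minusP /(_ 0%N). Qed.

Lemma iter_image_decr n : iter n.+1 phi @` cot U n.+1 `<=` iter n phi @` cot U n.
Proof.
move=> _ [x Ux <-]; exists (phi x); last by rewrite -iterSr.
by move: Ux; rewrite -add1n => /cotrajectoryD[].
Qed.

Lemma iter_image_compact n : compact (iter n phi @` cot U n).
Proof.
apply: image_compact; first exact: iter_continuous.
by apply: co_compact; exact: co_cotrajectory.
Qed.

(** The sets phi^n(U_{-n}) ∩ phi^-1{x} are compact and decreasing, and each is nonempty because [x]
    is in phi^{n+1}(U_{-n-1}). A common point is the required preimage. *)
Lemma plus_pre x : plus U x -> exists2 y, plus U y & phi y = x.
Proof.
move=> Px; have clx : closed [set x] by apply: compact_closed => //; exact: compact_set1.
pose A n := iter n phi @` cot U n `&` phi @^-1` [set x].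
have clA n : closed (A n).
  apply: closedI; last exact: preim_closed.
  by apply: compact_closed => //; exact: iter_image_compact.
have [|//|||y Ay] := @decreasing_bigcap_neq0 _ A.
- by apply: compact_closedI; [exact: iter_image_compact|exact: preim_closed].
- move=> n; have [z Uz zx] := Px n.+1 I; exists (iter n phi z); split=> //.
  by exists z => //; exact: cotrajectory_le Uz.
- by move=> n y [Py xy]; split=> //; exact: iter_image_decr.
by exists y; [move=> n _; exact: (Ay n I).1|exact: (Ay 0%N I).2].
Qed.

Lemma plus_past k x : plus U x -> exists y,
  iter k phi y = x /\ forall i, (i <= k)%N -> plus U (iter i phi y).
Proof.
elim: k x => [|k IH] x Px.
  by exists x; split=> // i; rewrite leqn0 => /eqP ->.
have [x1 Px1 x1x] := plus_pre Px; have [y [yx1 Py]] := IH _ Px1.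
exists y; split; first by rewrite iterS yx1.
by move=> i; rewrite leq_eqVlt => /orP[/eqP ->|]; [rewrite iterS yx1 x1x|rewrite ltnS; exact: Py].
Qed.

Lemma plus_forward y : plus U y -> U (phi y) -> plus U (phi y).
Proof.
move=> Py Uy [|n] _; first by exists (phi y) => //; rewrite cotrajectory0.
have [z Uz zy] := Py n I; exists z; last by rewrite iterS zy.
by rewrite cotrajectoryS; split=> //; rewrite /= zy.
Qed.

(* Elements of bi-infinite trajectories lying in U at all but finitely many
   times. *)
Definition homoclinic : set G :=
  [set x | exists m y n, [/\ plus U y, iter m phi y = x & minus U (iter n phi x)]].

(** Both times can be any large enough [M], since pasts in U_+ extend and U_- is forward invariant.
    This lets finitely many homoclinic points share one time. *)
Lemma homoclinic_lift x : homoclinic x -> exists M0, forall M, (M0 <= M)%N ->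
  exists y, [/\ plus U y, iter M phi y = x & minus U (iter M phi x)].
Proof.
move=> [m [y [n [Py yx nx]]]]; exists (maxn m n) => M.
rewrite geq_max => /andP[mM nM]; have [z [zy Pz]] := plus_past (M - m) Py.
exists z; split; first exact: (Pz 0%N).
- by rewrite -(subnKC mM) iterD zy.
- by rewrite -(subnK nM) iterD; exact: minus_iter.
Qed.

Lemma homoclinic_subgp : subgp homoclinic.
Proof.
split.
  exists 0%N, 1, 0%N; split=> //; first exact: subgp1.
  exact: subgp1.
move=> x x' /homoclinic_lift[M H] /homoclinic_lift[M' H'].
have [y [Py yx Mx]] := H _ (leq_maxl M M').
have [y' [Py' yx' Mx']] := H' _ (leq_maxr M M').
have itM := iter_morph phiM (maxn M M').
exists (maxn M M'), (y / y'), (maxn M M'); split.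
- exact: (subgpB sP).
- by rewrite itM (morphV itM) yx yx'.
- by rewrite itM (morphV itM); exact: (subgpB sM).
Qed.

Lemma homoclinic_iter i x : homoclinic x -> homoclinic (iter i phi x).
Proof.
move=> [m [y [n [Py yx nx]]]]; exists (i + m)%N, y, n; split=> //.
  by rewrite iterD yx.
by rewrite -iterD addnC iterD; exact: minus_iter.
Qed.

(** With L the homoclinic group, L ∩ phi U_+ lies in the compact set phi U, hence in U C for a
    finite subset C of it. Peeling off one factor per time step puts L ∩ phi^k U_+ inside U_+ D_k,
    where D_k is the product of the sets phi^i C for i < k. The factors with i >= M0 lie in U_-, so
    L is inside U D_M0 U, whatever k is. *)
Lemma homoclinic_compact : exists2 D, compact D & homoclinic `<=` D.
Proof.
pose L1 := homoclinic `&` phi @` plus U.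
have L11 : L1 1.
  split; first exact: subgp1 homoclinic_subgp.
  by exists 1; [exact: subgp1|exact: morph1].
have cphiU : compact (phi @` U) by apply: image_compact => //; exact: co_compact.
have L1U : L1 `<=` phi @` U by move=> _ [_ [y /plus_sub Uy <-]]; exists y.
have [C CL1 C_cov] := finite_rcoset_reps sU (co_open cU) cphiU L1U L11.
have [M0 M0P] : exists M0, forall c, c \in C -> forall M, (M0 <= M)%N ->
    minus U (iter M phi c).
  elim: C CL1 {C_cov} => [|c C IH] CL1; first by exists 0%N.
  have [|M1 M1P] := IH; first by move=> x xC; apply: CL1; rewrite inE xC orbT.
  have [/homoclinic_lift[M2 M2P] _] := CL1 c (mem_head _ _).
  exists (maxn M1 M2) => d; rewrite inE => /orP[/eqP ->|dC] M; rewrite geq_max => /andP[M1M M2M].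
    by have [y []] := M2P _ M2M.
  exact: M1P.
pose D := fix D k := if k is k'.+1 then prods (D k') (iter k' phi @` [set` C])
  else [set 1].
have cD k : compact (D k).
  elim: k => [|k IH] /=; first exact: compact_set1.
  apply: prods_compact => //; apply: image_compact; first exact: iter_continuous.
  by apply: finite_compact; exact: finite_seq.
(* [z / c] lies in [U] and is the image of a point of U_+, so it is in U_+ by [plus_forward]. *)
have L1E z : L1 z -> exists l c, [/\ homoclinic l, plus U l, c \in C & z = l * c].
  move=> L1z; have [c cC Uzc] := C_cov z L1z; have [hc [yc Pyc ycc]] := CL1 c cC.
  case: L1z => hz [yz Pyz yzz]; exists (z / c), c; split=> //; last by rewrite mulgVK.
    by apply: (subgpB homoclinic_subgp).
  have -> : z / c = phi (yz / yc) by rewrite phiM (morphV phiM) yzz ycc.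
  apply: plus_forward; first exact: (subgpB sP).
  by rewrite phiM (morphV phiM) yzz ycc.
have LD k z : homoclinic z -> (iter k phi @` plus U) z -> prods (plus U) (D k) z.
  elim: k z => [|k IH] z hz [y Py yz].
    exists z; first by rewrite -yz.
    by exists 1; rewrite ?mulg1.
  have [|l [c [hl Pl cC E]]] := @L1E (phi y).
  - split; last by exists y.
    have [m [y' [n [Py' yz' Mz]]]] := hz; exists 1%N, y, (n + k)%N; split=> //.
    by rewrite -[phi y]/(iter 1 phi y) -iterD -addnA addn1 iterD yz.
  - have [||u Pu [d Dd udl]] := IH (iter k phi l); first exact: homoclinic_iter.
      by exists l.
    exists u => //; exists (d * iter k phi c).
      by exists d => //; exists (iter k phi c) => //; exists c.
    by rewrite mulgA udl -iter_morph// -E -yz -iterSr.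
have DM k : D (k + M0)%N `<=` prods (D M0) (minus U).
  elim: k => [|k IH] x.
    by move=> Dx; exists x => //; exists 1; rewrite ?mulg1//; exact: subgp1.
  rewrite addSn => -[d /IH[e De [v Mv evd]] [_ [c cC <-] <-]].
  exists e => //; exists (v * iter (k + M0) phi c); last by rewrite mulgA evd.
  by apply: (subgpM sM) => //; apply: M0P => //; exact: leq_addl.
exists (prods U (prods (D M0) U)).
  by apply: prods_compact; [|apply: prods_compact]; rewrite //; exact: co_compact.
move=> z hz; have [M1 M1P] := homoclinic_lift hz.
have [y [Py yz _]] := M1P (M1 + M0)%N (leq_addr _ _).
have [|u Pu [d /DM[e De [v Mv evd]] udz]] := LD (M1 + M0)%N z hz; first by exists y.
exists u; first exact: plus_sub.
by exists d => //; exists e => //; exists v => //; exact: minus_sub.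
Qed.

End one_subgroup.
End trajectories.

(** * Tidiness of minimizing subgroups *)

Section tidiness.
Variables (R : realType) (G : topologicalGroupType).
Variable mu : {measure set (borel_type G) -> \bar R}.
Hypothesis hG : hausdorff_space G.
Hypothesis mu_haar : is_left_haar mu.
Variable phi : G -> G.
Hypotheses (phiM : {morph phi : x y / x * y}) (phi_cont : continuous phi).
Local Notation hs := (haar_size mu).
Local Notation cot := (cotrajectory phi).
Local Notation plus := (plus phi).
Local Notation minus := (minus phi).
Local Notation homoclinic := (homoclinic phi).

Variables (U : set G) (mU : minimizing phi U).

Let cU : compact_open_subgroup U. Proof. by case: mU. Qed.
Let sU : subgp U. Proof. exact: co_subgp. Qed.
Let ccot n : compact_open_subgroup (cot U n). Proof. exact: co_cotrajectory. Qed.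

(** phi^n induces an injection of the cosets of U_{-2n} in U_{-n} into the cosets of U_{-n} in [U].
    Both sets have s^n elements, so it is onto. *)
Lemma minimizing_factor_fin n x : U x ->
  exists2 p, cot U n p & cot U n ((iter n phi p)^-1 * x).
Proof.
have [k [g tr]] := transversal_exists (co_compact (ccot n))
  (co_subgp (ccot (n + n))) (co_open (ccot (n + n))).
have hsk : hs (cot U n) = (k%:R * hs (cot U (n + n)))%R.
  apply: (transversal_size mu_haar) tr => //.
  by apply: cotrajectory_le; exact: leq_addr.
have itM := iter_morph phiM n.
have pk : packing U (cot U n) k (iter n phi \o g).
  case: tr => -[gA pk] _; split=> [i /gA /cotrajectoryP|i j ki kj Bij]; first exact.
  apply: pk => //; apply/cotrajectoryD; split; last by rewrite itM (morphV itM).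
  by apply: (subgpVM (co_subgp (ccot n))); exact: gA.
have cov : transversal U (cot U n) k (iter n phi \o g).
  apply: (packing_covers hG mu_haar) => //; first exact: cotrajectory_sub.
  have E1 := minimizing_haar hG mu_haar phiM phi_cont n mU.
  have E2 := minimizing_haar hG mu_haar phiM phi_cont (n + n) mU.
  have s0 : ((scale phi)%:R ^+ n != 0 :> R)%R.
    by rewrite expf_neq0// pnatr_eq0 -lt0n; exact: (scale_gt0 hG mu_haar phiM phi_cont cU).
  have b0 : hs (cot U (n + n)) != 0%R by rewrite gt_eqF ?(haar_size_gt0 hG mu_haar).
  suff -> : k%:R = ((scale phi)%:R ^+ n)%R :> R by [].
  apply: (mulIf b0); rewrite -hsk; apply: (mulfI s0).
  by rewrite -E1 E2 exprD mulrA.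
move=> Ux; have [i ki Bix] := cov.2 x Ux.
exists (g i) => //; exact: tr.1.1.
Qed.

(** The limit of the finite factorizations: the sets phi^n(U_{-n}) ∩ x U_{-n} are compact,
    decreasing and nonempty, and a common point is the factor in U_+. *)
Lemma minimizing_factor x : U x -> exists2 p, plus U p & minus U (p^-1 * x).
Proof.
move=> Ux; pose A n := iter n phi @` cot U n `&` [set y | cot U n (y^-1 * x)].
have clA n : closed (A n).
  apply: closedI.
    by apply: compact_closed => //; exact: iter_image_compact.
  apply: (@preim_closed _ _ (fun y : G => y^-1 * x)); last exact: co_closed (ccot n).
  move=> y; apply: (@continuous_comp _ _ _ (fun z : G => z^-1) (fun z => z * x)).
    exact: invg_continuous.
  exact: mulgr_continuous.
have [|//|||y Ay] := @decreasing_bigcap_neq0 _ A.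
- apply: (@subclosed_compact _ _ (iter 0 phi @` cot U 0)); [exact: clA| |by move=> y []].
  exact: iter_image_compact.
- move=> n; have [p Up Upx] := minimizing_factor_fin n Ux.
  by exists (iter n phi p); split=> //; exists p.
- move=> n y [Py /= Uyx]; split; first exact: iter_image_decr Py.
  exact: (cotrajectory_le (leqnSn n) Uyx).
by exists y => n _; [exact: (Ay n I).1|exact: (Ay n I).2].
Qed.

Let sP : subgp (plus U).
Proof.
apply: subgp_bigcap => n _; apply: subgp_iter_image => //; exact: co_subgp.
Qed.

Let sM : subgp (minus U).
Proof. by apply: subgp_bigcap => n _; exact: co_subgp. Qed.

Let sL : subgp (homoclinic U).
Proof. exact: homoclinic_subgp. Qed.

Lemma minimizing_factorV x : U x -> exists2 q, minus U q & plus U (q^-1 * x).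
Proof.
move=> Ux; have [p Pp Mpx] := minimizing_factor (subgpV sU Ux).
exists (p^-1 * x^-1)^-1; first exact: (subgpV sM).
by rewrite invgK mulgVK; exact: (subgpV sP).
Qed.

(** Split g = q u along U_- U_+, then phi^n u along U_+ U_- with first factor [v], and lift [v] to
    [w] with phi^n w = v and orbit in U_+ up to time [n]. Then l = w^-1 u works, with g / l = q
    w. *)
Lemma homoclinic_factor n g : U g -> U (iter n phi g) ->
  exists l, [/\ plus U l, minus U (iter n phi l) & cot U n (g / l)].
Proof.
move=> Ug Ung; have [q Mq Pu] := minimizing_factorV Ug.
set u := q^-1 * g in Pu; have itM := iter_morph phiM n.
have Uu : U (iter n phi u).
  rewrite itM (morphV itM); apply: (subgpVM sU) => //.
  by move/minusP: Mq; exact.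
have [v Pv Mv] := minimizing_factor Uu.
have [w [wv Pw]] := plus_past hG phiM phi_cont cU n Pv.
exists (w^-1 * u); split.
- by apply: (subgpVM sP) => //; exact: (Pw 0%N).
- by rewrite itM (morphV itM) wv.
- have -> : g / (w^-1 * u) = q * w by rewrite invgM invgK mulgA /u invgM invgK mulgA mulgV mul1g.
  apply: (subgpM (co_subgp (ccot n))).
    by apply/cotrajectoryP => i _; move/minusP: Mq; exact.
  by apply/cotrajectoryP => i ni; apply: plus_sub; exact: Pw.
Qed.

Let UL : set G := prods U (homoclinic U).

Let ULP x : UL x <-> exists2 l, homoclinic U l & U (x / l).
Proof.
split=> [[u Uu [l Ll <-]]|[l Ll Uxl]]; first by exists l => //; rewrite mulgK.
by exists (x / l) => //; exists l => //; rewrite mulgVK.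
Qed.

Lemma homoclinic_factor_mem n i g : (i <= n)%N -> U g -> U (iter n phi g) ->
  UL (iter i phi g).
Proof.
move=> ni Ug Ung; have [l [Pl Ml Ugl]] := homoclinic_factor Ug Ung.
have itM := iter_morph phiM i.
apply/ULP; exists (iter i phi l).
  by apply: homoclinic_iter => //; exists 0%N, l, n.
by rewrite -(morphV itM) -itM; move/cotrajectoryP: Ugl; exact.
Qed.

Let K := stabilizer (homoclinic U) UL.

Let ULM u x : U u -> UL x -> UL (u * x).
Proof.
move=> Uu /ULP[l Ll Uxl]; apply/ULP; exists l => //.
by rewrite -mulgA; exact: (subgpM sU).
Qed.

Let LK : homoclinic U `<=` K.
Proof.
move=> x Lx l Ll; split; apply/ULP.
  by exists (l * x); [exact: (subgpM sL)|rewrite mulgV; exact: subgp1].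
by exists (l / x); [exact: (subgpB sL)|rewrite mulgV; exact: subgp1].
Qed.

Let sK : subgp K.
Proof.
have ULx x y : (forall l, homoclinic U l -> UL (l * y)) -> UL x -> UL (x * y).
  move=> Ky /ULP[l Ll Uxl]; rewrite -[x](mulgVK l) -mulgA.
  by apply: ULM => //; exact: Ky.
split; first by apply: LK; exact: subgp1 sL.
move=> x y Kx Ky l Ll; rewrite invgF !mulgA; split.
  apply: ULx; first by move=> k Lk; exact: (Ky k Lk).2.
  exact: (Kx l Ll).1.
apply: ULx; first by move=> k Lk; exact: (Kx k Lk).2.
exact: (Ky l Ll).1.
Qed.

Let reps : exists2 s : seq G, (forall l, l \in s -> homoclinic U l) &
    forall x, homoclinic U x -> exists2 l, l \in s & U (x / l).
Proof.
have [D cD LD] := homoclinic_compact hG phiM phi_cont cU.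
exact: (finite_rcoset_reps sU (co_open cU) cD LD (subgp1 sL)).
Qed.

(** Since U L is stable under left multiplication by [U], the condition defining [K] need only be
    tested on finitely many representatives; this makes [K] open. *)
Let stab_reps (s : seq G) : (forall x, homoclinic U x -> exists2 l, l \in s & U (x / l)) ->
  stabilizer [set` s] UL `<=` K.
Proof.
move=> cov x Sx l Ll; have [k ks Ulk] := cov l Ll.
have [ULkx ULkVx] := Sx k ks.
rewrite -[l](mulgVK k); split; rewrite -mulgA; exact: ULM.
Qed.

Let cUL : compact UL.
Proof.
have [s sL' cov] := reps.
have -> : UL = prods U [set` s].
  apply/seteqP; split=> x.
    move=> /ULP[l Ll Uxl]; have [k ks Ulk] := cov l Ll.
    exists (x / k); last by exists k; rewrite ?mulgVK.
    by rewrite -[x](mulgVK l) -mulgA; exact: (subgpM sU).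
  by move=> [u Uu [k ks <-]]; exists u => //; exists k => //; exact: sL'.
apply: prods_compact; first exact: co_compact.
by apply: finite_compact; exact: finite_seq.
Qed.

Let cK : compact_open_subgroup K.
Proof.
have oK : open K.
  have [s sL' cov] := reps.
  apply: (subgp_nbhs_open sK); apply: filterS (stab_reps cov) _.
  apply: stabilizer_nbhs.
  - by apply: finite_compact; exact: finite_seq.
  - by apply: prods_openl; exact: co_open.
  - move=> k ks; apply/ULP; exists k; first exact: sL'.
    by rewrite mulgV; exact: subgp1.
split=> //; first by apply: (iffLR (subgp_closed _)).
apply: (subclosed_compact _ cUL); first exact: open_subgp_closed.
by move=> x /(_ 1 (subgp1 sL))[]; rewrite mul1g.
Qed.

(** The finitely many representatives [k] share a time [M] with k = phi^M y, [y] in U_+, and phi^M k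
    in [U]. For [x] in U_{-2M}, both y x and phi^{2M}(y x) are in [U], so halfway k phi^M(x) is in U
    L. *)
Let deep_mem : exists M, forall x, cot U (M + M) x -> K (iter M phi x).
Proof.
have [s sL' cov] := reps.
have [M MP] : exists M, forall l, l \in s -> exists2 y, plus U y &
    iter M phi y = l /\ minus U (iter M phi l).
  have [M0 MP] : exists M0, forall l, l \in s -> forall M, (M0 <= M)%N ->
      exists y, [/\ plus U y, iter M phi y = l & minus U (iter M phi l)].
    elim: s sL' {cov} => [|l s IH] sL'; first by exists 0%N.
    have [|M1 M1P] := IH; first by move=> x xs; apply: sL'; rewrite inE xs orbT.
    have [M2 M2P] := homoclinic_lift hG phiM phi_cont cU (sL' l (mem_head _ _)).
    exists (maxn M1 M2) => k; rewrite inE => /orP[/eqP ->|ks] M;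
      rewrite geq_max => /andP[M1M M2M]; [exact: M2P|exact: M1P].
  by exists M0 => l /MP /(_ M0 (leqnn _))[y [Py yl Ml]]; exists y.
exists M => x Ux; apply: (stab_reps cov) => k ks.
have [y Py [yk Mk]] := MP k ks; have Uy := plus_sub Py.
have key z : cot U (M + M) z -> UL (k * iter M phi z).
  move=> /cotrajectoryP Uz; rewrite -yk -(iter_morph phiM).
  apply: (@homoclinic_factor_mem (M + M)); first exact: leq_addr.
    by apply: (subgpM sU) => //; exact: (Uz 0%N).
  rewrite (iter_morph phiM); apply: (subgpM sU); last exact: Uz.
  by rewrite iterD yk; exact: (minus_sub Mk).
split; first exact: key.
rewrite -(morphV (iter_morph phiM M)); apply: key.
exact: (subgpV (co_subgp (ccot _))).
Qed.

(* Otherwise translates in time of a homoclinic point outside U yield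
   arbitrarily many cosets of U_{-n} in K_{-n}, making the subgroups K_{-n}
   too large for the minimality of the scale. *)
Lemma minimizing_homoclinic : homoclinic U `<=` U.
Proof.
move=> z [p [y [q [Py yz Mz]]]]; apply: contrapT => nUz.
have [M MP] := deep_mem.
pose s : R := (scale phi)%:R%R.
have s0 : (0 < s)%R by rewrite ltr0n (scale_gt0 hG mu_haar phiM phi_cont cU).
pose B := U `&` cot K M.
have cB : compact_open_subgroup B by apply: coI => //; exact: co_cotrajectory.
have hU0 := haar_size_gt0 hG mu_haar cU.
have hB0 := haar_size_gt0 hG mu_haar cB.
have bound J : (J%:R * hs U <= s ^+ M * (hs U / hs B) * hs K)%R.
  (* [n] exceeds every time p + p i, i < J, at which the point [w i] below reaches [z]. [E] lies in
     K_{-n}, yet up to the fixed factor [U : B] it is as large as U_{-n-M}. *)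
  pose n := (p * J + p)%N; pose E := cot U (n + M) `&` B.
  have cE : compact_open_subgroup E by exact: coI.
  (* Up to time [M] the iterates are in [K] by the choice of [B]; the later ones are M-th iterates
     of points of U_{-2M}. *)
  have EK : E `<=` cot K n.
    move=> x [/cotrajectoryP Ux [_ /cotrajectoryP Kx]].
    apply/cotrajectoryP => i ni; have [/Kx//|Mi] := leqP i M.
    rewrite -(subnKC (ltnW Mi)) iterD; apply: MP.
    apply/cotrajectoryP => j jM; rewrite -iterD; apply: Ux.
    by rewrite (leq_trans (leq_add jM (leqnn _)))// -addnA subnKC ?(ltnW Mi)// addnC leq_add2r.
  (* [w j] delays [y] by p j steps inside U_+. For i < j, at time p + p i the orbit of [w i] is at
     [z], outside [U], while that of [w j] is still in [U]; so their cosets of U_{-n} differ. *)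
  have /choice[w wP] : forall j : nat, exists w, iter (p * j) phi w = y /\
      forall i, (i <= p * j)%N -> plus U (iter i phi w).
    by move=> j; exact: plus_past.
  have pk : packing (cot K n) E J w.
    have lt_case i j : (i < j)%N -> (j < J)%N -> cot U n ((w i)^-1 * w j) -> False.
      move=> ij jJ /cotrajectoryP /(_ (p + p * i)%N).
      have itM := iter_morph phiM (p + p * i).
      have pn : (p + p * i <= n)%N.
        by rewrite addnC leq_add2r leq_mul2l (ltnW (ltn_trans ij jJ)) orbT.
      move=> /(_ pn); rewrite itM (morphV itM) [iter _ _ (w i)]iterD (wP i).1 yz => Uzw.
      apply: nUz; rewrite -[z]invgK; apply: (subgpV sU).
      apply: (subgpMr sU) Uzw; apply: plus_sub; apply: (wP j).2.
      by rewrite -mulnS leq_mul2l ij orbT.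
    split=> [j jJ|i j iJ jJ [Eij _]].
      apply/cotrajectoryP => i _; apply: LK; apply: homoclinic_iter => //.
      exists 0%N, (w j), (q + (p + p * j))%N; split=> //; first exact: ((wP j).2 0%N).
      by rewrite iterD [iter (p + _) _ _]iterD (wP j).1 yz.
    have {}Eij : cot U n ((w i)^-1 * w j) by apply: cotrajectory_le Eij; exact: leq_addr.
    case: (ltngtP i j) => // ij; exfalso; first exact: (lt_case i j).
    apply: (lt_case j i) => //; move/(subgpV (co_subgp (ccot n))): Eij.
    by rewrite invgM invgK.
  (* [J] translates of [E] fit into K_{-n}, whose measure is at most s^-n times that of [K], while
     that of [E] is at least a fixed multiple of s^-n. The powers cancel and bound [J]. *)
  have J1 : (J%:R * hs E <= hs (cot K n))%R.
    by apply: (packing_le mu_haar) pk => //; exact: co_cotrajectory.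
  have J2 : (s ^+ n * hs (cot K n) <= hs K)%R.
    exact: haar_size_cotrajectory.
  have J3 : hs U = (s ^+ (n + M) * hs (cot U (n + M)))%R.
    exact: minimizing_haar.
  have J4 : (hs (cot U (n + M)) <= hs U / hs B * hs E)%R.
    apply: (index_restrict hG mu_haar (U := U)) => //.
    - by move=> x [].
    - exact: cotrajectory_sub.
    - by rewrite divfK// gt_eqF.
  rewrite [X in (_ * X <= _)%R]J3 exprD.
  apply: (@le_trans _ _ (J%:R * (s ^+ n * s ^+ M * (hs U / hs B * hs E)))%R).
    by rewrite ler_wpM2l// ler_wpM2l// mulr_ge0// exprn_ge0// ltW.
  have -> : (J%:R * (s ^+ n * s ^+ M * (hs U / hs B * hs E)) =
      s ^+ M * (hs U / hs B) * (s ^+ n * (J%:R * hs E)))%R by ring.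
  rewrite ler_wpM2l//; first by rewrite mulr_ge0 ?exprn_ge0 ?divr_ge0// ltW.
  by apply: le_trans J2; rewrite ler_wpM2l// exprn_ge0// ltW.
set C := (s ^+ M * (hs U / hs B) * hs K)%R in bound.
have C0 : (0 <= C / hs U)%R.
  rewrite divr_ge0 ?(ltW hU0)// mulr_ge0 ?(ltW (haar_size_gt0 hG mu_haar cK))//.
  by rewrite mulr_ge0 ?exprn_ge0 ?divr_ge0// ltW.
have := archi_boundP C0; rewrite ltr_pdivrMr// => /lt_le_trans /(_ (bound _)).
by rewrite ltxx.
Qed.

(** Divide [x] by the [l] of [homoclinic_factor]: the quotient is in U_{-n}, and all iterates of [l]
    up to time [n] are homoclinic, hence in [U]. *)
Lemma minimizing_tidy n x : U x -> U (iter n phi x) -> cot U n x.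
Proof.
move=> Ux Unx; have [l [Pl Ml Uxl]] := homoclinic_factor Ux Unx.
rewrite -[x](mulgVK l); apply: (subgpM (co_subgp (ccot n))) => //.
apply/cotrajectoryP => i ni; apply: minimizing_homoclinic.
by apply: homoclinic_iter => //; exists 0%N, l, n.
Qed.

End tidiness.

(** By Bernoulli's inequality, (t / s)^n grows at least linearly. *)
Lemma exponential_not_bounded (R : realType) (s t C : R) :
  (0 < s)%R -> (s < t)%R -> ~ forall n, (t ^+ n <= C * s ^+ n)%R.
Proof.
move=> s0 st bound; pose e := (t / s - 1)%R.
have e0 : (0 < e)%R by rewrite subr_gt0 ltr_pdivlMr// mul1r.
have bernoulli n : (1 + n%:R * e <= (t / s) ^+ n)%R.
  elim: n => [|n IH]; first by rewrite expr0 mul0r addr0.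
  have ts : (t / s = 1 + e)%R by rewrite /e; ring.
  have ne : (0 <= n%:R * e * e)%R by rewrite !mulr_ge0// ltW.
  rewrite exprSr; apply: (@le_trans _ _ ((1 + n%:R * e) * (t / s))%R).
    by rewrite ts -natr1; lra.
  by rewrite ler_wpM2r// ts addr_ge0// ltW.
have {}bound n : (1 + n%:R * e <= C)%R.
  apply: (le_trans (bernoulli n)); rewrite expr_div_n ler_pdivrMr ?exprn_gt0//.
have C0 : (0 <= C / e)%R.
  rewrite divr_ge0 ?(ltW e0)//; apply: le_trans (bound 0%N).
  by rewrite mul0r addr0.
have := archi_boundP C0; rewrite ltr_pdivrMr// => /ltW Ce.
have := le_trans (bound (Num.bound (C / e))) Ce.
by rewrite gerDr; apply/negP; rewrite -ltNge.
Qed.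

(** * The nub *)

Section nub.
Variables (R : realType) (G : topologicalGroupType).
Variable mu : {measure set (borel_type G) -> \bar R}.
Hypothesis hG : hausdorff_space G.
Hypothesis mu_haar : is_left_haar mu.
Variable phi : G -> G.
Hypotheses (phiM : {morph phi : x y / x * y}) (phi_cont : continuous phi).
Implicit Types (U V W M : set G).
Local Notation hs := (haar_size mu).
Local Notation cot := (cotrajectory phi).

Let ccot U n : compact_open_subgroup U -> compact_open_subgroup (cot U n).
Proof. exact: co_cotrajectory. Qed.

(** Each index [U_{-m} : U_{-m-1}] is then at least s + 1, and the product telescopes. *)
Lemma not_minimizing_haar U n : compact_open_subgroup U ->
  (forall n, ~ minimizing phi (cot U n)) ->
  ((scale phi).+1%:R ^+ n * hs (cot U n) <= hs U)%R.
Proof.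
move=> cU nmin; elim: n => [|n IH]; first by rewrite cotrajectory0 expr0 mul1r.
apply: le_trans IH; rewrite exprSr -mulrA ler_wpM2l ?exprn_ge0//.
rewrite -cotrajectory_cotrajectory1 leNgt; apply/negP => small.
by apply: (nmin n); apply/(minimizingP hG mu_haar phiM phi_cont (ccot n cU)).
Qed.

(** Put O = U ∩ V and q = [U : O]. Tidiness of [V] gives O_{-n} = U_{-n} ∩ O ∩ phi^-n O, hence
    [U_{-n} : O_{-n}] <= q^2 for all n. If no O_{-n} were minimizing, its measure would decay at
    least like (s + 1)^-n, against the exact rate s^-n of U_{-n}. *)
Lemma minimizing_directed U V : minimizing phi U -> minimizing phi V ->
  exists2 W, minimizing phi W & W `<=` U `&` V.
Proof.
move=> mU mV; have [cU _] := mU; have [cV _] := mV.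
pose O := U `&` V; have cO : compact_open_subgroup O by exact: coI.
have [[n mO]|nmin] := pselect (exists n, minimizing phi (cot O n)).
  by exists (cot O n) => //; exact: cotrajectory_sub.
exfalso; pose s : R := (scale phi)%:R%R.
have s0 : (0 < s)%R by rewrite ltr0n (scale_gt0 hG mu_haar phiM phi_cont cU).
have hU0 := haar_size_gt0 hG mu_haar cU; have hO0 := haar_size_gt0 hG mu_haar cO.
pose q := (hs U / hs O)%R.
have q0 : (0 <= q)%R by rewrite divr_ge0// ltW.
have hUO : (hs U <= q * hs O)%R by rewrite divfK// gt_eqF.
have OU : O `<=` U by move=> x [].
have small n := not_minimizing_haar n cO (fun m mO => nmin (ex_intro _ m mO)).
apply: (@exponential_not_bounded _ s (scale phi).+1%:R%R (q * q * hs O / hs U)%R s0).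
  by rewrite ltr_nat.
move=> n; have cA : compact_open_subgroup (cot U n `&` O) by apply: coI => //; exact: ccot.
have b1 : (hs (cot U n) <= q * hs (cot U n `&` O))%R.
  apply: (index_restrict hG mu_haar (U := U)) => //; first exact: ccot.
  exact: cotrajectory_sub.
have b2 : (hs (cot U n `&` O) <= q * hs (cot O n))%R.
  have -> : cot O n = cot U n `&` O `&` iter n phi @^-1` O.
    apply/seteqP; split=> x.
      move=> Ox; split; last by move/cotrajectoryP: Ox; exact.
      by split; [apply: cotrajectory_mono OU _ Ox|exact: cotrajectory_sub Ox].
    move=> [[Unx [Ux Vx]] [Ux' Vx']]; rewrite cotrajectoryI; split=> //.
    by apply: (minimizing_tidy hG mu_haar phiM phi_cont mV).
  apply: (index_preim hG mu_haar (U := U)) => //.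
  - exact: iter_morph.
  - exact: iter_continuous.
  - by move=> x [/cotrajectoryP Ux _]; exact: Ux.
rewrite -(ler_pM2r hU0) mulrAC divfK ?gt_eqF//.
rewrite [X in (_ * X)%R](minimizing_haar hG mu_haar phiM phi_cont n mU).
have b3 : (hs (cot U n) <= q * (q * hs (cot O n)))%R.
  by apply: (le_trans b1); rewrite ler_wpM2l.
apply: (@le_trans _ _ ((scale phi).+1%:R ^+ n * (s ^+ n * (q * (q * hs (cot O n)))))%R).
  by rewrite ler_wpM2l ?exprn_ge0// ler_wpM2l// exprn_ge0// ltW.
have -> : ((scale phi).+1%:R ^+ n * (s ^+ n * (q * (q * hs (cot O n)))) =
  q * q * s ^+ n * ((scale phi).+1%:R ^+ n * hs (cot O n)))%R by ring.
have -> : (q * q * hs O * s ^+ n = q * q * s ^+ n * hs O)%R by ring.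
apply: ler_wpM2l (small n); apply: mulr_ge0; first exact: mulr_ge0.
by rewrite exprn_ge0// ltW.
Qed.

Section nonempty.
Variables (U0 : set G) (cU0 : compact_open_subgroup U0).

Lemma minimizing_exists : exists M, minimizing phi M.
Proof.
have [[V cV dV] _] := scaleP phiM phi_cont cU0.
by exists V.
Qed.

Lemma minimizing_sub_nbhs O : open O -> nub phi `<=` O ->
  exists2 M, minimizing phi M & M `<=` O.
Proof.
move=> oO NO; have [M0 mM0] := minimizing_exists; have [cM0 _] := mM0.
(* Intersecting with a fixed [M0] puts the whole directed family inside one compact set. *)
have [|||||_ [M [mM <-]] MO] := @directed_bigcap_sub _ M0
  [set A | exists M, minimizing phi M /\ M `&` M0 = A] O (co_compact cM0).
- by exists (M0 `&` M0), M0.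
- move=> _ [M [[cM _] <-]]; split; last by move=> x [].
  by apply: closedI; exact: co_closed.
- move=> _ _ [A [mA <-]] [B [mB <-]].
  have [C mC CAB] := minimizing_directed mA mB; exists (C `&` M0); first by exists C.
  by move=> x [/CAB[Ax Bx] Mx].
- exact: oO.
- move=> x Mx; apply: NO => M mM.
  by have [|//] := Mx (M `&` M0); exists M.
have [M' mM' M'M] := minimizing_directed mM mM0.
by exists M' => // x /M'M /MO.
Qed.

Lemma nub_subgp : subgp (nub phi).
Proof. by apply: subgp_bigcap => M [cM _]; exact: co_subgp. Qed.

Lemma nub_compact : compact (nub phi).
Proof.
have [M mM] := minimizing_exists; have [cM _] := mM.
apply: (subclosed_compact _ (co_compact cM)); last by move=> x; exact.
by apply: closed_bigI => A [cA _]; exact: co_closed.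
Qed.

(** The intersection of the conjugates of [U] by [N]; it is a neighbourhood of 1 because conjugation
    is jointly continuous and [N] is compact. *)
Lemma normal_core N U : compact N -> subgp N -> compact_open_subgroup U ->
  exists V, [/\ compact_open_subgroup V, V `<=` U &
    forall g x, N g -> V x -> V (g * x / g)].
Proof.
move=> cN sN cU; pose V := [set x | forall g, N g -> U (g * x / g)].
have VU : V `<=` U by move=> x /(_ 1 (subgp1 sN)); rewrite divg1 mul1g.
have sV : subgp V.
  split=> [g Ng|x y Vx Vy g Ng]; first by rewrite mulg1 mulgV; exact: subgp1 (co_subgp cU).
  have -> : g * (x / y) / g = (g * x / g) / (g * y / g).
    by rewrite [RHS]mulgKA invgM !mulgA.
  by apply: (subgpB (co_subgp cU)); [exact: Vx|exact: Vy].
have oV : open V.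
  apply: (subgp_nbhs_open sV); move/compact_near_coveringP: cN => cN.
  apply: (cN G (nbhs 1) (fun x g => U (g * x / g))) => g Ng.
  have : (fun p : G * G => p.1 * p.2 / p.1) @ (g, 1) --> g * 1 / g.
    apply: mulg_cvg; first by apply: mulg_cvg; [exact: cvg_fst|exact: cvg_snd].
    by apply: cvg_comp; [exact: cvg_fst|exact: invg_continuous].
  rewrite mulg1 mulgV => /(_ U); apply.
  by apply: open_nbhs_nbhs; split; [exact: co_open|exact: subgp1 (co_subgp cU)].
exists V; split=> //; first exact: (co_subset cU).
move=> g x Ng Vx h Nh.
have -> : h * (g * x / g) / h = (h * g) * x / (h * g) by rewrite invgM !mulgA.
by apply: Vx; exact: subgpM.
Qed.

(* A proper such W would yield the minimizing subgroup U2 W \cap M, where M is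
   minimizing inside U2 N and U2 is small and normalized by N; but its trace on
   the nub N is only W. *)
Lemma nub_no_open_stable W : subgp W -> W `<=` nub phi ->
  (exists2 U, compact_open_subgroup U & nub phi `&` U `<=` W) ->
  (forall x, W x -> W (phi x)) -> nub phi `<=` W.
Proof.
move=> sW WN [U cU NUW] phiW; set N := nub phi in WN NUW *.
have cN : compact N := nub_compact; have sN : subgp N := nub_subgp.
have [U1 [cU1 U1U nU1]] := normal_core cN sN cU.
(* [U2] and its image under [phi] both lie in [U1]; as [N] normalizes [U2], the product U2 W is a
   subgroup. *)
have [U2 [cU2 U2U1 nU2]] := normal_core cN sN (co_preim phiM phi_cont cU1 cU1).
have [|x Nx|M mM MUN] := @minimizing_sub_nbhs (prods U2 N).
- by apply: prods_openl; exact: co_open.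
- by exists 1; [exact: subgp1 (co_subgp cU2)|exists x; rewrite ?mul1g].
have [cM dM] := mM.
have sUW : subgp (prods U2 W).
  split.
    exists 1; first exact: subgp1 (co_subgp cU2).
    by exists 1; rewrite ?mul1g//; exact: subgp1.
  move=> _ _ [u Uu [w Ww <-]] [v Uv [z Wz <-]].
  exists (u * ((w / z) * v^-1 / (w / z))).
    apply: (subgpM (co_subgp cU2)) => //; apply: nU2.
      by apply: WN; exact: subgpB.
    exact: (subgpV (co_subgp cU2)).
  exists (w / z); first exact: subgpB.
  by rewrite !invgM !mulgA !mulgVK.
pose V := M `&` prods U2 W.
have cV : compact_open_subgroup V.
  apply: (co_subset cM); last by move=> x [].
    by apply: subgpI => //; exact: co_subgp.
  by apply: openI; [exact: co_open|apply: prods_openl; exact: co_open].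
have VM : V `<=` M by move=> x [].
have mV : minimizing phi V.
  apply/(minimizingP hG mu_haar phiM phi_cont cV).
  have b1 : (hs V <= (scale phi)%:R * hs (V `&` cot M 1))%R.
    apply: (index_restrict hG mu_haar (U := M)) => //; first exact: ccot.
      exact: cotrajectory_sub.
    by rewrite (displacement_haar mu_haar phiM phi_cont cM dM).
  apply: (le_lt_trans b1); apply: (@le_lt_trans _ _ ((scale phi)%:R * hs (cot V 1))%R).
    rewrite ler_wpM2l//; apply: (haar_size_le mu_haar); [|exact: ccot|].
      by apply: coI => //; exact: ccot.
    (* For x = u w in V ∩ M_{-1}, [phi x] is in [M] and so equals v n with [v] in [U2] and [n] in
       [N]. Then n / phi w = v^-1 phi u is in N ∩ U1, hence in [W], and so is [n]. *)
    move=> x [Vx]; rewrite !cotrajectory1 => -[Mx Mpx]; split=> //; split=> //.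
    have [_ [u /U2U1[U1u U1pu] [w Ww uwx]]] := Vx.
    have [v U2v [n Nn vnx]] := MUN _ Mpx; exists v => //; exists n => //.
    apply: (subgpMr sW (subgpV sW (phiW w Ww))); apply: NUW; split.
      by apply: (subgpB sN) => //; apply: WN; exact: phiW.
    apply: U1U; have -> : n / phi w = v^-1 * phi u.
      apply: (@mulgI _ v); rewrite mulVKg mulgA vnx -uwx phiM.
      by rewrite mulgK.
    by apply: (subgpVM (co_subgp cU1)) => //; exact: (U2U1 v U2v).1.
  by rewrite ltr_pM2r ?ltr_nat// haar_size_gt0//; exact: ccot.
move=> x Nx; have [_ [u U2u [w Ww uwx]]] := Nx V mV.
rewrite -uwx; apply: (subgpM sW) => //; apply: NUW; split.
  by apply: (subgpMr sN (WN w Ww)); rewrite uwx.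
by apply: U1U; exact: (U2U1 u U2u).1.
Qed.

End nonempty.
End nub.

(** * Entropy *)

Section limsup_log.
Variables (R : realType) (r : nat -> R).
Hypothesis r_gt0 : forall n, (0 < r n)%R.
Local Notation rate n := (- (n%:R^-1)%R%:E * lne (r n)%:E)%E.

Let rateE n : rate n = (- n%:R^-1 * ln (r n))%:E%R.
Proof. by rewrite lne_EFin// -EFinN -EFinM. Qed.

Lemma limsup_rate_le (s c : R) : (0 < s)%R -> (0 < c)%R ->
  (forall n, (c <= s ^+ n * r n)%R) -> (limn_esup (fun n => rate n) <= (ln s)%:E)%E.
Proof.
move=> s0 c0 bound; apply/lee_addgt0Pr => e e0.
(* Beyond [N] the error |ln c| / n is below e; the successor excludes n = 0, where the inverse takes
   its default value. *)
pose N := (Num.bound (`|ln c| / e)).+1.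
apply: (@le_trans _ _ (ereal_sup ((fun n => rate n) @` [set n | (N <= n)%N]))).
  by apply: ereal_inf_lbound; exists [set n | (N <= n)%N] => //; exists N.
apply: ge_ereal_sup => _ [n /= Nn <-]; rewrite rateE -EFinD lee_fin.
have n0 : (0 < n%:R :> R)%R by rewrite ltr0n (leq_trans _ Nn).
have cn : (`|ln c| <= e * n%:R)%R.
  have : (0 <= `|ln c| / e)%R by rewrite divr_ge0// ltW.
  move=> /archi_boundP; rewrite ltr_pdivrMr// mulrC => /ltW /le_trans; apply.
  by rewrite ler_wpM2l ?(ltW e0)// ler_nat (leq_trans _ Nn).
have h2 : (ln c <= n%:R * ln s + ln (r n))%R.
  rewrite mulr_natl -lnXn// -lnM ?posrE ?exprn_gt0//.
  by rewrite ler_ln ?posrE ?mulr_gt0 ?exprn_gt0.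
rewrite -(ler_pM2l n0) mulrA mulrN divff ?gt_eqF// mulN1r mulrDr.
have := ler_norm (- ln c); rewrite normrN => h1.
lra.
Qed.

Lemma limsup_rate_ge (t C : R) : (0 < t)%R -> (0 < C)%R ->
  (forall n, (t ^+ n * r n <= C)%R) -> ((ln t)%:E <= limn_esup (fun n => rate n))%E.
Proof.
move=> t0 C0 bound; apply: le_ereal_inf_tmp => _ [V [N _ NV] <-].
apply/lee_addgt0Pr => e e0.
pose n := (maxn N (Num.bound (`|ln C| / e))).+1.
have n0 : (0 < n%:R :> R)%R by rewrite ltr0n.
apply: (@le_trans _ _ (rate n + e%:E)%E); last first.
  apply: leeD2r; apply: ereal_sup_ubound; exists n => //; apply: NV.
  by rewrite /= /n leqW// leq_maxl.
rewrite rateE -EFinD lee_fin.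
have Cn : (`|ln C| <= e * n%:R)%R.
  have : (0 <= `|ln C| / e)%R by rewrite divr_ge0// ltW.
  move=> /archi_boundP; rewrite ltr_pdivrMr// mulrC => /ltW /le_trans; apply.
  by rewrite ler_wpM2l ?(ltW e0)// ler_nat /n leqW// leq_maxr.
have h2 : (n%:R * ln t + ln (r n) <= ln C)%R.
  rewrite mulr_natl -lnXn// -lnM ?posrE ?exprn_gt0//.
  by rewrite ler_ln ?posrE ?mulr_gt0 ?exprn_gt0.
rewrite -(ler_pM2l n0) mulrDr mulrA mulrN divff ?gt_eqF// mulN1r.
have := ler_norm (ln C) => h1.
lra.
Qed.

End limsup_log.

Section entropy_bounds.
Variables (R : realType) (G : topologicalGroupType).
Variable mu : {measure set (borel_type G) -> \bar R}.
Hypothesis hG : hausdorff_space G.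
Hypothesis mu_haar : is_left_haar mu.
Variable phi : G -> G.
Hypotheses (phiM : {morph phi : x y / x * y}) (phi_cont : continuous phi).
Variables (U : set G) (cU : compact_open_subgroup U).
Local Notation hs := (haar_size mu).
Local Notation cot := (cotrajectory phi).

Let ccot n : compact_open_subgroup (cot U n). Proof. exact: co_cotrajectory. Qed.

Let H_topE : H_top mu phi U =
  limn_esup (fun n => (- (n%:R^-1)%R%:E * lne (hs (cot U n))%:E)%E).
Proof.
by rewrite /H_top; congr limn_esup; apply/funext => n; rewrite -haar_sizeE.
Qed.

Lemma H_top_le (s c : R) : (0 < s)%R -> (0 < c)%R ->
  (forall n, (c <= s ^+ n * hs (cot U n))%R) -> (H_top mu phi U <= (ln s)%:E)%E.
Proof.
move=> s0 c0 bound; rewrite H_topE; apply: limsup_rate_le c0 bound => // n.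
exact: haar_size_gt0.
Qed.

Lemma H_top_ge (t C : R) : (0 < t)%R -> (0 < C)%R ->
  (forall n, (t ^+ n * hs (cot U n) <= C)%R) -> ((ln t)%:E <= H_top mu phi U)%E.
Proof.
move=> t0 C0 bound; rewrite H_topE; apply: limsup_rate_ge C0 bound => // n.
exact: haar_size_gt0.
Qed.

Lemma H_top_ge_scale : ((ln (scale phi)%:R)%:E <= H_top mu phi U)%E.
Proof.
apply: (@H_top_ge _ (hs U)).
- by rewrite ltr0n; exact: (scale_gt0 hG mu_haar phiM phi_cont cU).
- exact: haar_size_gt0.
- by move=> n; exact: haar_size_cotrajectory.
Qed.

Lemma H_top_le_minimizing M : minimizing phi M -> M `<=` U ->
  (H_top mu phi U <= (ln (scale phi)%:R)%:E)%E.
Proof.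
move=> mM MU; have [cM _] := mM.
apply: (@H_top_le _ (hs M)).
- by rewrite ltr0n; exact: (scale_gt0 hG mu_haar phiM phi_cont cU).
- exact: haar_size_gt0.
- move=> n; rewrite (minimizing_haar hG mu_haar phiM phi_cont n mM).
  rewrite ler_wpM2l ?exprn_ge0//; apply: haar_size_le => //; last exact: cotrajectory_mono.
  exact: co_cotrajectory.
Qed.

(** Otherwise all indices are at least s + 1 and the entropy is at least ln (s + 1). *)
Lemma minimizing_of_H_top : (H_top mu phi U <= (ln (scale phi)%:R)%:E)%E ->
  exists n, minimizing phi (cot U n).
Proof.
move=> hU; apply: contrapT => nmin.
have : ((ln (scale phi).+1%:R)%:E <= H_top mu phi U)%E.
  apply: (@H_top_ge _ (hs U)); first by rewrite ltr0n.
    exact: haar_size_gt0.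
  move=> n; apply: not_minimizing_haar => // m mO; apply: nmin.
  by exists m.
move=> /le_trans /(_ hU); rewrite lee_fin leNgt ltr_ln ?posrE ?ltr_nat//.
  by rewrite ltnSn.
by rewrite ltr0n; exact: (scale_gt0 hG mu_haar phiM phi_cont cU).
Qed.

(** A proper subgroup has at most half the measure, so strict decrease at every step would give
    entropy at least ln 2. *)
Lemma cotrajectory_stable_of_H_top : (H_top mu phi U <= 0)%E ->
  exists n, cot U n `<=` cot U n.+1.
Proof.
move=> hU; apply: contrapT => nstab.
have : ((ln 2)%:E <= H_top mu phi U)%E.
  apply: (@H_top_ge _ (hs U)); first by rewrite ltr0n.
    exact: haar_size_gt0.
  elim=> [|n IH]; first by rewrite cotrajectory0 expr0 mul1r.
  apply: le_trans IH; rewrite exprSr -mulrA ler_wpM2l ?exprn_ge0//.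
  have [x [Ux nUx]] : exists x, cot U n x /\ ~ cot U n.+1 x.
    apply: contrapT => nx; apply: nstab; exists n => x Ux.
    by apply: contrapT => nUx; apply: nx; exists x.
  apply: (haar_size_double mu_haar _ _ _ Ux nUx) => //.
  exact: cotrajectory_le.
move=> /le_trans /(_ hU); rewrite lee_fin leNgt ln_gt0//.
by rewrite ltr1n.
Qed.

End entropy_bounds.

(** * The nub as a topological group in its own right *)

Section nub_type.
Variables (G : topologicalGroupType) (phi : G -> G).
Hypothesis hG : hausdorff_space G.
Hypotheses (phiM : {morph phi : x y / x * y}) (phi_cont : continuous phi).
Local Notation N := (nub_type phi).
Local Notation psi := (nub_restriction phi).
Let v : N -> G := val.

Let v_inj : injective v. Proof. exact: val_inj. Qed.

Let v_cont : continuous v.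
Proof. exact: (@initial_continuous (set_type (nub phi)) G set_val). Qed.

Let vN x : nub phi (v x).
Proof. exact: (set_mem (valP (x : set_type (nub phi)))). Qed.

Let v_lift x : nub phi x -> exists y, v y = x.
Proof. by move=> Nx; exists (SigSub (mem_set Nx) : set_type (nub phi)). Qed.

Lemma nub_type_hausdorff : hausdorff_space N.
Proof.
move=> x y clxy; apply: v_inj; apply: hG => A B Ax By.
have [z [Az Bz]] := clxy (v @^-1` A) (v @^-1` B) (v_cont Ax) (v_cont By).
by exists (v z).
Qed.

Let nbhs_nub (x : N) (B : set N) : nbhs x B ->
  exists2 A, nbhs (v x) A & v @^-1` A `<=` B.
Proof.
rewrite nbhsE => -[_ [[A oA <-] Ax] AB]; exists A => //.
by apply: open_nbhs_nbhs.
Qed.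

Lemma nub_type_co U : compact (nub phi) -> compact_open_subgroup U ->
  compact_open_subgroup (v @^-1` U : set N).
Proof.
move=> cN cU; have sU := co_subgp cU; split.
- apply: (iffLR (subgp_closed _)); split; first exact: subgp1 sU.
  by move=> x y Ux Uy; exact: (subgpB sU Ux Uy).
- have cNU : compact (nub phi `&` U) by apply: compact_closedI => //; exact: co_closed.
  (* The filter is pushed forward to the compact subset nub ∩ U of [G], and its cluster point is
     pulled back along the induced topology. *)
  move=> F PF FU.
  have [|x [[Nx Ux] clx]] := cNU (v @ F).
    by apply: (@filterS _ F _ (v @^-1` U)) => // y Uy; split=> //; exact: vN.
  have [y yx] := v_lift Nx; exists y; split; first by rewrite /= yx.
  move=> A B FA /nbhs_nub[B' B'x B'B]; rewrite yx in B'x.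
  have [|_ [[a Aa <-] B'a]] := clx (v @` A) B' _ B'x.
    by apply: (@filterS _ F _ A) => // a Aa; exists a.
  by exists a; split=> //; exact: B'B.
- by apply: preim_open => //; exact: co_open.
Qed.

Hypothesis stable : forall x, nub phi x -> nub phi (phi x).

Lemma nub_restriction_val x : v (psi x) = phi (v x).
Proof. exact: nub_restrictionE. Qed.

Lemma nub_restrictionM : {morph psi : x y / x * y}.
Proof.
move=> x y; apply: v_inj; rewrite nub_restriction_val.
rewrite -[RHS]/(v (psi x) * v (psi y)) !nub_restriction_val.
exact: phiM.
Qed.

Lemma nub_restriction_continuous : continuous psi.
Proof.
apply: (@continuous_comp_initial (set_type (nub phi)) N G set_val) => x.
have -> : set_val \o psi = phi \o v.
  by apply/funext => y; exact: nub_restriction_val.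
by apply: continuous_comp; [exact: v_cont|exact: phi_cont].
Qed.

Lemma cotrajectory_nub U n x :
  cotrajectory psi (v @^-1` U) n x <-> cotrajectory phi U n (v x).
Proof.
have E i : v (iter i psi x) = iter i phi (v x).
  by elim: i => [//|i IH]; rewrite !iterS nub_restriction_val IH.
by split=> /cotrajectoryP H; apply/cotrajectoryP => i /H; rewrite /= E.
Qed.

End nub_type.

(** * Equivalence of the entropy and nub conditions *)

Unset Implicit Arguments.
Set Strict Implicit.
Local Open Scope ring_scope.

Theorem corollary4p11 (R : realType) (G : topologicalGroupType)
    (G_hausdorff : hausdorff_space G)
    (G_td : totally_disconnected [set: G])
    (G_lc : locally_compact [set: G])
    (phi : {multiplicative G -> G}) (phi_continuous : continuous phi)
    (mu : {measure set (borel_type G) -> \bar R})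
    (mu_haar : is_left_haar mu)
    (nu : {measure set (borel_type (nub_type phi)) -> \bar R})
    (nu_haar : is_left_haar nu) :
  [<-> h_top mu phi = (ln (scale phi)%:R)%:E;
       nub phi = [set 1%g];
       h_top nu (nub_restriction phi) = 0%:E].
Proof.
have phiM : {morph phi : x y / (x * y)%g} by move=> x y; exact: gmulfM.
have base := fun O => @van_dantzig G O G_hausdorff G_td G_lc.
have [U0 cU0 _] := base setT (@openT G) I.
have stable := nub_stable G_hausdorff mu_haar phiM phi_continuous.
have hN := nub_type_hausdorff (phi := phi) G_hausdorff.
have cN := nub_compact phiM phi_continuous cU0.
have psiM := nub_restrictionM phiM stable.
have psi_cont := nub_restriction_continuous phi_continuous stable.
tfae.
- move=> hphi; apply/seteqP; split=> [x Nx|_ -> U [cU _]]; last exact: subgp1 (co_subgp cU).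
  (* A compact open subgroup [U] avoiding [x] has full entropy at most log s, so some U_{-n} is
     minimizing and contains the nub, although it misses [x]. *)
  apply: contrapT => x1; have [||U cU Ux] := base (~` [set x]).
  + apply: closed_openC; apply: compact_closed => //; exact: compact_set1.
  + by move=> /= /esym.
  have [|n mU] := minimizing_of_H_top G_hausdorff mu_haar phiM phi_continuous cU.
    by rewrite -hphi; apply: ereal_sup_ubound; exists U.
  by apply: (Ux x) => //; apply: cotrajectory_sub (Nx _ mU).
- move=> N1.
  have all1 (x : nub_type phi) : x = 1%g.
    have N1' z : nub phi z -> z = 1%g by rewrite N1.
    apply: val_inj; apply: N1'.
    exact: (set_mem (valP (x : set_type (nub phi)))).
  (* The trivial nub has only one subgroup, whose cotrajectories are constant; its entropy is
     bounded on both sides by ln 1. *)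
  have full (K : set (nub_type phi)) : K 1%g -> K = setT.
    by move=> K1; apply/seteqP; split=> // x _; rewrite (all1 x).
  have cT : compact_open_subgroup [set: nub_type phi].
    by have := nub_type_co cN cU0; rewrite (full (_ @^-1` _))//; exact: subgp1 (co_subgp cU0).
  have hT0 := haar_size_gt0 hN nu_haar cT.
  have ln1E : 0%:E = (ln 1)%:E :> \bar R by rewrite ln1.
  have cotT n : cotrajectory (nub_restriction phi) setT n = setT by apply/seteqP.
  apply/eqP; rewrite eq_le; apply/andP; split.
    apply: ge_ereal_sup => _ [K cK <-]; rewrite (full K (subgp1 (co_subgp cK))).
    rewrite ln1E.
    apply: (H_top_le hN nu_haar psiM psi_cont cT ltr01 hT0) => n.
    by rewrite cotT expr1n mul1r.
  apply: (@le_trans _ _ (H_top nu (nub_restriction phi) setT)); last first.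
    by apply: ereal_sup_ubound; exists setT.
  rewrite ln1E.
  apply: (H_top_ge hN nu_haar psiM psi_cont cT ltr01 hT0) => n.
  by rewrite cotT expr1n mul1r.
- move=> hpsi.
  have NU U : compact_open_subgroup U -> nub phi `<=` U.
    move=> cU; have cV := nub_type_co cN cU.
    have [|n stab] := cotrajectory_stable_of_H_top hN nu_haar psiM psi_cont cV.
      apply: (@le_trans _ _ (h_top nu (nub_restriction phi))); last by rewrite hpsi.
      by apply: ereal_sup_ubound; exists (val @^-1` U).
    have cUn := co_cotrajectory phiM phi_continuous n cU.
    apply: (@subset_trans _ (nub phi `&` cotrajectory phi U n)); last first.
      by move=> x [_ /cotrajectory_sub].
    (* By [stab], the trace of U_{-n} on the nub lies in U_{-n-1}, so [phi] maps this trace into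
       itself; being open in the nub, it is the whole nub. *)
    apply: (nub_no_open_stable G_hausdorff mu_haar phiM phi_continuous cU0).
    + by apply: subgpI; [exact: nub_subgp|exact: co_subgp].
    + by move=> x [].
    + by exists (cotrajectory phi U n).
    + move=> x [Nx Ux]; split; first exact: stable.
      pose y : nub_type phi := SigSub (mem_set Nx) : set_type (nub phi).
      have : cotrajectory (nub_restriction phi) (val @^-1` U) n y.
        exact/(cotrajectory_nub stable).
      by move=> /stab /(cotrajectory_nub stable); rewrite -add1n => /cotrajectoryD[].
  apply/eqP; rewrite eq_le; apply/andP; split.
    apply: ge_ereal_sup => _ [U cU <-].
    have [M mM MU] := minimizing_sub_nbhs G_hausdorff mu_haar phiM phi_continuous
      cU0 (co_open cU) (NU U cU).
    exact: H_top_le_minimizing mM MU.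
  apply: (@le_trans _ _ (H_top mu phi U0)); first exact: H_top_ge_scale.
  by apply: ereal_sup_ubound; exists U0.
Qed.
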